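(* Let $H$ be a periodic Jacobi matrix on a tree. Then $H$ has no singular continuous spectrum; that is, no spectral measure of the self-adjoint operator $H$ has a nonzero singular continuous part.
   Context: Let $\mathcal{G}$ be a finite connected graph (self-loops and multiple edges are allowed) in which every vertex is an end of some edge and which has no leaves, i.e. no vertex of degree $1$ (a self-loop counts twice in the degree). Assign a real number $B_v$ to every vertex $v$ of $\mathcal{G}$ and a strictly positive real number $A_e$ to every edge $e$ of $\mathcal{G}$. Let $\mathcal{T}$ be the universal cover of $\mathcal{G}$, which is an infinite tree, and let $\Xi:\mathcal{T}\to\mathcal{G}$ be the covering map (sending vertices to vertices and edges to edges). The periodic Jacobi matrix built over these data is the bounded self-adjoint operator $H$ on $\ell^2$ of the vertices of $\mathcal{T}$ given by $$(Hu)(x)=B_{\Xi(x)}\,u(x)+\sum_{\alpha=(xy)}A_{\Xi(\alpha)}\,u(y),$$ where the sum is over all edges $\alpha$ of $\mathcal{T}$ having $x$ as an end, $y$ being the other end. Any operator arising this way is called a periodic Jacobi matrix on a tree. *)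

(* Defs.v *)
From HB Require Import structures.
From mathcomp Require Import all_boot all_order all_algebra.
From mathcomp Require Import all_classical all_reals all_analysis.
From mathcomp Require Import complex.
Set Implicit Arguments.
Unset Strict Implicit.
Unset Printing Implicit Defensive.
Import Order.TTheory GRing.Theory Num.Theory.
Local Open Scope classical_set_scope.
Local Open Scope ring_scope.
Local Open Scope complex_scope.

(* Undirected graphs with self-loops and multiple edges, in Serre's style: an
   edge is a pair {d, drev d} of opposite darts (half-edges).  A self-loop at v
   consists of two distinct darts, both with source v, so it counts twice in
   the degree of v. *)
Record graph (V D : Type) := Graph {
  src : D -> V;
  drev : D -> D;
  drevK : involutive drev;
  drev_neq : forall d, drev d <> d }.

Definition tgt (V D : Type) (G : graph V D) (d : D) : V := src G (drev G d).

Definition deg (V D : finType) (G : graph V D) (v : V) : nat :=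
  #|[pred d : D | src G d == v]|.

Fixpoint walk (V D : Type) (G : graph V D) (x : V) (p : seq D) (y : V) : Prop :=
  if p is d :: q then src G d = x /\ walk G (tgt G d) q y else x = y.

Fixpoint reduced (V D : Type) (G : graph V D) (p : seq D) : Prop :=
  if p is d :: ((e :: _) as q) then e <> drev G d /\ reduced G q else True.

Definition connected_graph (V D : Type) (G : graph V D) : Prop :=
  inhabited V /\ forall x y, exists p, walk G x p y.

Definition tree (V D : Type) (G : graph V D) : Prop :=
  connected_graph G /\
  forall x p, walk G x p x -> reduced G p -> p = [::].

(* pv and pd are the actions of the covering map on vertices and on darts.
   Surjectivity follows from the connectedness of the base. *)
Record covering (VT DT V D : Type) (T : graph VT DT) (G : graph V D)
    (pv : VT -> V) (pd : DT -> D) : Prop := Covering {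
  cov_src : forall d, src G (pd d) = pv (src T d);
  cov_rev : forall d, pd (drev T d) = drev G (pd d);
  cov_lift : forall x e, src G e = pv x ->
    exists! d, src T d = x /\ pd d = e }.

(* A covering by a connected and simply connected graph, that is, by a tree;
   it is unique up to isomorphism. *)
Definition universal_cover (VT DT V D : Type) (T : graph VT DT)
    (G : graph V D) (pv : VT -> V) (pd : DT -> D) : Prop :=
  tree T /\ covering T G pv pd.

Section l2.
Variables (R : realType) (V : choiceType).
Implicit Types (u v : V -> R[i]).

Definition l2 u : Prop :=
  (\esum_(x in [set: V]) (complex.Re (u x) ^+ 2 + complex.Im (u x) ^+ 2)%:E < +oo)%E.

(* Unconditional sums, meaningful for absolutely summable families. *)
Definition rsum (f : V -> R) : R :=
  fine (\esum_(x in [set: V]) (Num.max (f x) 0)%:E -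
        \esum_(x in [set: V]) (Num.max (- f x) 0)%:E)%E.

Definition csum (f : V -> R[i]) : R[i] :=
  rsum (fun x => complex.Re (f x)) +i* rsum (fun x => complex.Im (f x)).

Definition dot u v : R[i] := csum (fun x => (u x)^* * v x).

(* Operators on l2 are represented by maps on all functions V -> C, of which
   only the restriction to l2 is relevant. *)
Record orthogonal_projection (P : (V -> R[i]) -> V -> R[i]) : Prop := OrthProj {
  proj_l2 : forall u, l2 u -> l2 (P u);
  proj_linear : forall (a : R[i]) u v, l2 u -> l2 v ->
    P (fun x => a * u x + v x) = (fun x => a * P u x + P v x);
  proj_idem : forall u, l2 u -> P (P u) = P u;
  proj_sym : forall u v, l2 u -> l2 v -> dot (P u) v = dot u (P v) }.

(* mu is the measure B |-> <u, E(B) u>. *)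
Definition scalar_measure
    (E : set (measurableTypeR R) -> (V -> R[i]) -> V -> R[i]) u
    (mu : {measure set (measurableTypeR R) -> \bar R}) : Prop :=
  forall B, measurable B ->
    dot u (E B u) = (fine (mu B))%:C /\ mu B \is a fin_num.

Record resolution_of_identity
    (E : set (measurableTypeR R) -> (V -> R[i]) -> V -> R[i]) : Prop :=
  ResolutionOfIdentity {
  roi_proj : forall B, measurable B -> orthogonal_projection (E B);
  roi_set0 : forall u, l2 u -> E set0 u = (fun=> 0);
  roi_setT : forall u, l2 u -> E setT u = u;
  roi_setI : forall A B u, measurable A -> measurable B -> l2 u ->
    E (A `&` B) u = E A (E B u);
  roi_measure : forall u, l2 u ->
    exists mu : {measure set (measurableTypeR R) -> \bar R},
      scalar_measure E u mu }.

(* For a bounded self-adjoint H: E is the projection-valued measure of the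
   spectral theorem, H = \int t dE(t). *)
Definition spectral_resolution (H : (V -> R[i]) -> V -> R[i])
    (E : set (measurableTypeR R) -> (V -> R[i]) -> V -> R[i]) : Prop :=
  resolution_of_identity E /\
  forall u (mu : {measure set (measurableTypeR R) -> \bar R}),
    l2 u -> scalar_measure E u mu ->
    mu.-integrable setT (fun t => t%:E) /\
    dot u (H u) = (\int[mu]_t t)%:C.

Definition spectral_measure (H : (V -> R[i]) -> V -> R[i]) u
    (mu : {measure set (measurableTypeR R) -> \bar R}) : Prop :=
  exists E, spectral_resolution H E /\ scalar_measure E u mu.

End l2.

Section sc_part.
Variable R : realType.
Implicit Types mu nu : {measure set (measurableTypeR R) -> \bar R}.

Definition pure_point nu : Prop :=
  exists2 C : set (measurableTypeR R), countable C & nu (~` C) = 0%E.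

Definition singular_continuous nu : Prop :=
  (exists N : set (measurableTypeR R),
    [/\ measurable N, @lebesgue_measure R N = 0%E & nu (~` N) = 0%E]) /\
  forall x : measurableTypeR R, nu [set x] = 0%E.

(* nu is the singular continuous part in the Lebesgue decomposition
   mu = mu_ac + mu_sc + mu_pp. *)
Definition sc_part mu nu : Prop :=
  exists ac pp : {measure set (measurableTypeR R) -> \bar R},
    [/\ ac `<< @lebesgue_measure R, singular_continuous nu, pure_point pp &
        forall B, measurable B -> mu B = (ac B + nu B + pp B)%E].

End sc_part.

Definition no_singular_continuous_spectrum (R : realType) (V : choiceType)
    (H : (V -> R[i]) -> V -> R[i]) : Prop :=
  forall u mu nu, l2 u -> spectral_measure H u mu -> sc_part mu nu ->
    forall B, measurable B -> nu B = 0%E.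

(* In a tree no edge has equal ends, so the darts with source x correspond to
   the edges having x as an end, tgt being the other end. *)
Definition periodic_jacobi (R : realType) (V D : Type) (VT DT : choiceType)
    (T : graph VT DT) (pv : VT -> V) (pd : DT -> D) (B : V -> R) (A : D -> R)
    (u : VT -> R[i]) : VT -> R[i] := fun x =>
  (B (pv x))%:C * u x +
  \sum_(d \in [set d | src T d = x]) (A (pd d))%:C * u (tgt T d).

(* Main.v *)
From HB Require Import structures.
Require Import Defs.
From mathcomp Require Import all_boot all_order all_algebra.
From mathcomp Require Import all_classical all_reals all_analysis.
From mathcomp Require Import measurable_realfun.
From mathcomp Require Import complex polyrcf ordered_qelim qe_rcf.
From mathcomp Require Import ring lra.

(** Let [u = (H - z)^-1 delta_x], [z = t + i eps].  Its values along the tree are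
    products of m-functions of the darts of the finite graph, which solve a
    finite polynomial system; a solution with positive imaginary parts exists for
    every [eps > 0] because the system is the fixed-point equation of a
    contraction for the hyperbolic metric, and it produces [u] directly.  The set
    of the [t] for which [Im u(x)] is unbounded as [eps -> 0] is definable over
    the ordered field of the reals, so by quantifier elimination it is a finite
    set or contains an interval.  An interval is impossible: on it [Im u(x)],
    which is bounded by a Poisson integral of the spectral measure [mu_x] of
    [delta_x], would tend to infinity, against Fatou's lemma, the Poisson
    integrals having bounded mass.  Off the finite exceptional set,
    [mu_x(t - eps, t + eps) <= 2 eps Im u(x) = O(eps)], so [mu_x] gives measure
    zero to the Lebesgue null sets which avoid the exceptional set.  Hence the
    spectral projection of such a set annihilates every [delta_x], and is zero. *)

(** The argument avoids boundary values and branches of algebraic functions. That Im m is unbounded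
    as [eps -> 0] is a condition on all solutions of the system, hence first order as it stands, and
    its negation bounds in particular the solution supplied by the contraction. Tameness acts twice:
    in [t], from a bad point off a finite set to an interval; in [eps], from arbitrarily small to
    all small [eps], as the liminf in Fatou's lemma requires.

    [spectral_resolution] gives only the first moment, [<u, H u>] as the integral of [t], so the
    Poisson formula for Im u(x) cannot be quoted. From this quadratic form come the symmetry of [H],
    its commutation with [E] and a norm bound for [H - c] on the range of [E I], for [I] an interval
    around [c]. Intervals of length comparable to [eps] then yield two inequalities in place of the
    formula, with the losses 2 and 10.

    The exceptional set depends on the finite graph alone, so one finite set serves every [delta_x];
    a singular continuous measure gives it no mass. *)

Set Implicit Arguments.
Unset Strict Implicit.
Unset Printing Implicit Defensive.
Import Order.TTheory GRing.Theory Num.Theory.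
Local Open Scope ring_scope.

(** * Definable predicates over a real closed field and quantifier elimination *)

Section Definable.
Variable R : rcfType.
Implicit Types (e : seq R) (S : seq R -> Prop) (p : {poly R}).

Definition definable S := exists f : ord.formula R, forall e, ord.holds e f <-> S e.

Definition term_fun (g : seq R -> R) :=
  exists t : GRing.term R, forall e, GRing.eval e t = g e.

Lemma term_fun_const c : term_fun (fun=> c).
Proof. by exists (GRing.Const c). Qed.

Lemma term_fun_var i : term_fun (fun e => e`_i).
Proof. by exists (GRing.Var _ i). Qed.

Lemma term_funD g h : term_fun g -> term_fun h -> term_fun (fun e => g e + h e).
Proof. by move=> [s Es] [t Et]; exists (GRing.Add s t) => e /=; rewrite Es Et. Qed.

Lemma term_funM g h : term_fun g -> term_fun h -> term_fun (fun e => g e * h e).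
Proof. by move=> [s Es] [t Et]; exists (GRing.Mul s t) => e /=; rewrite Es Et. Qed.

Lemma term_funN g : term_fun g -> term_fun (fun e => - g e).
Proof. by move=> [s Es]; exists (GRing.Opp s) => e /=; rewrite Es. Qed.

Lemma term_fun_sum (I : Type) (r : seq I) (g : I -> seq R -> R) :
  (forall i, term_fun (g i)) -> term_fun (fun e => \sum_(i <- r) g i e).
Proof.
move=> hg; elim: r => [|i r [t Et]].
  by exists (GRing.Const 0) => e; rewrite big_nil.
have [s Es] := hg i; exists (GRing.Add s t) => e.
by rewrite big_cons /= Es Et.
Qed.

Lemma definable_eq g h : term_fun g -> term_fun h -> definable (fun e => g e = h e).
Proof. by move=> [s Es] [t Et]; exists (ord.Equal s t) => e /=; rewrite Es Et. Qed.

Lemma definable_lt g h : term_fun g -> term_fun h -> definable (fun e => g e < h e).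
Proof. by move=> [s Es] [t Et]; exists (ord.Lt s t) => e /=; rewrite Es Et. Qed.

Lemma definable_and S S' :
  definable S -> definable S' -> definable (fun e => S e /\ S' e).
Proof.
move=> [f Ef] [g Eg]; exists (ord.And f g) => e /=.
by split=> -[/Ef ? /Eg ?].
Qed.

Lemma definable_imp S S' :
  definable S -> definable S' -> definable (fun e => S e -> S' e).
Proof.
move=> [f Ef] [g Eg]; exists (ord.Implies f g) => e /=.
by split=> h /Ef /h /Eg.
Qed.

Lemma definable_all (I : finType) (S : I -> seq R -> Prop) :
  (forall i, definable (S i)) -> definable (fun e => forall i, S i e).
Proof.
move=> hS; suff [f Ef] : definable (fun e => forall i, i \in enum I -> S i e).
  by exists f => e; split=> [/Ef h i|h]; [exact/h/mem_enum | exact/Ef].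
elim: (enum I) => [|i r [f Ef]]; first by exists (ord.Bool true).
have [g Eg] := hS i; exists (ord.And g f) => e; split=> /=.
  move=> [/Eg gi /Ef fr] j; rewrite inE => /predU1P[-> //|].
  exact: fr.
move=> h; split; first by apply/Eg/h/mem_head.
by apply/Ef => j jr; apply: h; rewrite inE jr orbT.
Qed.

Lemma definable_forall i S :
  definable S -> definable (fun e => forall x, S (set_nth 0 e i x)).
Proof.
by move=> [f Ef]; exists (ord.Forall i f) => e /=; split=> h x; apply/Ef.
Qed.

Lemma definable_exists i S :
  definable S -> definable (fun e => exists x, S (set_nth 0 e i x)).
Proof.
by move=> [f Ef]; exists (ord.Exists i f) => e /=; split=> -[x] /Ef h; exists x.
Qed.

(** Formulas read an environment only through [nth] with default 0, so environments of different
    lengths can be indistinguishable. *)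
Lemma definable_ext S e e' :
  definable S -> (forall i, e`_i = e'`_i) -> S e -> S e'.
Proof. by move=> [f Ef] ee' /Ef he; apply/Ef; apply: ord.eq_holds he => i. Qed.

(** Choosing a new environment that may differ only on a block of [n] slots amounts to [n]
    first-order quantifiers; in this way a whole vector of unknowns is bound. *)
Lemma definable_exists_block k n S : definable S ->
  definable (fun e => exists e',
    (forall i, ~~ (k <= i < k + n)%N -> e'`_i = e`_i) /\ S e').
Proof.
move=> dS; elim: n => [|n IH].
  have [f Ef] := dS; exists f => e; split=> [/Ef Se|[e' [ee' Se']]].
    by exists e.
  apply/Ef; apply: definable_ext dS _ Se' => i.
  by apply: ee'; rewrite addn0; case: (leqP k i).
have [f Ef] := definable_exists (k + n) IH; exists f => e; split.
  move=> /Ef[x [e' [ee' Se']]]; exists e'; split=> // i hi.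
  rewrite ee' ?nth_set_nth /=.
    by case: eqP => // ik; move: hi; rewrite ik leq_addr addnS ltnSn.
  apply: contra hi => /andP[-> /= ikn]; rewrite addnS; exact: ltnW.
move=> [e' [ee' Se']]; apply/Ef; exists e'`_(k + n); exists e'; split=> // i hi.
rewrite nth_set_nth /=; case: eqP => [-> //|/eqP ik].
apply: ee'; apply: contra hi => /andP[-> /=].
by rewrite addnS ltnS leq_eqVlt (negPf ik).
Qed.

(** The roots of [p] cut the line into finitely many intervals on each of which [P] is constant.
    With a polynomial as witness instead of a list of intervals, Boolean combinations reduce to
    products of polynomials. *)
Definition tame (P : R -> Prop) := exists2 p : {poly R}, p != 0 &
  forall a b, a <= b -> (forall x, a <= x <= b -> ~~ root p x) -> (P a <-> P b).

Lemma tame_not P : tame P -> tame (fun x => ~ P x).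
Proof.
move=> [p p0 hp]; exists p => // a b ab nr.
by have := hp a b ab nr; tauto.
Qed.

Lemma tame_op (op : Prop -> Prop -> Prop) P Q :
  (forall A B A' B', (A <-> A') -> (B <-> B') -> (op A B <-> op A' B')) ->
  tame P -> tame Q -> tame (fun x => op (P x) (Q x)).
Proof.
move=> hop [p p0 hp] [q q0 hq]; exists (p * q); first by rewrite mulf_neq0.
move=> a b ab nr; apply: hop; [apply: hp|apply: hq] => // x /nr;
  by rewrite rootM negb_or => /andP[].
Qed.

Lemma tame_root p : tame (fun x => p.[x] = 0).
Proof.
have [->|p0] := eqVneq p 0.
  by exists 1; [exact: oner_neq0|move=> a b _ _; rewrite !horner0].
exists p => // a b ab nr.
by split=> /eqP; [have := nr a | have := nr b]; rewrite /root !lexx ab => /(_ isT)/negP.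
Qed.

(** By the intermediate value theorem, a change of sign forces a root in between. *)
Lemma tame_lt0 p : tame (fun x => p.[x] < 0).
Proof.
have [->|p0] := eqVneq p 0.
  by exists 1; [exact: oner_neq0|move=> a b _ _; rewrite !horner0].
exists p => // a b ab nr.
have na : p.[a] != 0 by apply: (nr a); rewrite lexx ab.
have nb : p.[b] != 0 by apply: (nr b); rewrite lexx ab.
have [/(poly_ivtoo ab)[x xab rx]|] := ltP (p.[a] * p.[b]) 0.
  have := nr x; rewrite rx => /(_ _)/negP[] //.
  by move: xab; rewrite in_itv /= => /andP[/ltW -> /ltW ->].
move: na nb; case: ltgtP => // ha _; case: ltgtP => // hb _.
- by rewrite leNgt (nmulr_rlt0 _ ha) hb.
- by rewrite leNgt (pmulr_rlt0 _ ha) hb.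
Qed.

(** [rterm] excludes inverses, the only constructor whose value need not be polynomial in the
    variable. *)
Lemma eval_poly e i (t : GRing.term R) : GRing.rterm t ->
  exists p, forall x, GRing.eval (set_nth 0 e i x) t = p.[x].
Proof.
elim: t => //=.
- move=> j _; exists (if j == i then 'X else (e`_j)%:P) => x.
  by rewrite nth_set_nth /=; case: eqP => _; rewrite !hornerE.
- by move=> c _; exists c%:P => x; rewrite hornerC.
- by move=> n _; exists n%:R%:P => x; rewrite hornerC.
- by move=> s IHs t IHt /andP[/IHs[p hp] /IHt[q hq]]; exists (p + q) => x;
    rewrite hornerE hp hq.
- by move=> s IHs /IHs[p hp]; exists (- p) => x; rewrite hornerE hp.
- by move=> s IHs n /IHs[p hp]; exists (p *+ n) => x; rewrite hornerMn hp.
- by move=> s IHs t IHt /andP[/IHs[p hp] /IHt[q hq]]; exists (p * q) => x;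
    rewrite hornerE hp hq.
- by move=> s IHs n /IHs[p hp]; exists (p ^+ n) => x; rewrite horner_exp hp.
Qed.

Lemma tame_ext (P Q : R -> Prop) : (forall x, P x <-> Q x) -> tame P -> tame Q.
Proof.
move=> PQ [p p0 hp]; exists p => // a b ab nr.
by rewrite -!PQ; exact: hp.
Qed.

Lemma tame_qf e i (f : ord.formula R) : ord.qf_form f && ord.rformula f ->
  tame (fun x => ord.holds (set_nth 0 e i x) f).
Proof.
have tameF P : (forall a b, P a <-> P b) -> tame P.
  by move=> h; exists 1; [exact: oner_neq0|move=> a b _ _].
elim: f => //=.
- by move=> b _; apply: tameF.
- move=> s t /andP[/(@eval_poly e i)[p hp] /(@eval_poly e i)[q hq]].
  apply: tame_ext (tame_root (p - q)) => x.
  by rewrite !hornerE hp hq; split=> [/eqP|->]; rewrite ?subrr // subr_eq0 => /eqP.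
- move=> s t /andP[/(@eval_poly e i)[p hp] /(@eval_poly e i)[q hq]].
  by apply: tame_ext (tame_lt0 (p - q)) => x; rewrite !hornerE hp hq subr_lt0.
- move=> s t /andP[/(@eval_poly e i)[p hp] /(@eval_poly e i)[q hq]].
  apply: tame_ext (tame_not (tame_lt0 (q - p))) => x.
  by rewrite !hornerE hp hq subr_lt0 leNgt; split=> /negP.
- move=> f IHf g IHg /andP[/andP[qf qg] /andP[rf rg]].
  apply: tame_op; [tauto|by apply: IHf; rewrite qf|by apply: IHg; rewrite qg].
- move=> f IHf g IHg /andP[/andP[qf qg] /andP[rf rg]].
  apply: tame_op; [tauto|by apply: IHf; rewrite qf|by apply: IHg; rewrite qg].
- move=> f IHf g IHg /andP[/andP[qf qg] /andP[rf rg]].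
  apply: (@tame_op (fun A B => A -> B));
    [tauto|by apply: IHf; rewrite qf|by apply: IHg; rewrite qg].
- by move=> f IHf /IHf; apply: tame_not.
Qed.

(** [to_rform] removes inverses and elimination removes quantifiers; what remains is a Boolean
    combination of polynomial sign conditions in the chosen variable. *)
Lemma definable_tame e i S : definable S -> tame (fun x => S (set_nth 0 e i x)).
Proof.
move=> [f Ef].
have rf := ord.to_rform_rformula f.
have qf := ord.quantifier_elim_wf (@wf_QE_wproj R) rf.
apply: tame_ext (tame_qf e i qf) => x.
case/andP: qf => qf _.
have h := ord.quantifier_elim_rformP
  (@wf_QE_wproj R) (@valid_QE_wproj R) (set_nth 0 e i x) rf.
split=> [/(ord.qf_evalP _ qf)/h/ord.to_rformP/Ef //|].
by move=> /Ef/ord.to_rformP/h/(ord.qf_evalP _ qf).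
Qed.

End Definable.

(** * Local constancy of tame predicates *)

Section Tame.
Variable R : rcfType.
Implicit Types (P : R -> Prop) (p : {poly R}).

Lemma seq_isolated (s : seq R) x :
  exists2 d, 0 < d & forall y, y \in s -> `|y - x| < d -> y = x.
Proof.
elim: s => [|r s [d d0 hd]]; first by exists 1.
have [rx|rx] := eqVneq r x.
  by exists d => // y; rewrite inE => /predU1P[->|/hd].
exists (Num.min d `|r - x|); first by rewrite lt_min d0 normr_gt0 subr_eq0.
move=> y; rewrite inE lt_min => /predU1P[->|ys] /andP[h1 h2].
  by rewrite ltxx in h2.
exact: hd.
Qed.

Lemma root_isolated p x : p != 0 ->
  exists2 d, 0 < d & forall y, root p y -> `|y - x| < d -> y = x.
Proof.
move=> p0; have [d d0 hd] := seq_isolated (rootsR p) x; exists d => // y ry.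
apply: hd; have := roots_on_rootsR p0 => /(_ y); rewrite in_itv /= => <-.
exact: ry.
Qed.

(** Roots of [p] other than [x] stay away from [x]. Applied at [x = 0] in the variable [eps], this
    upgrades a property of some arbitrarily small [eps] to all small [eps]. *)
Lemma tame_right P x : tame P ->
  exists2 d, 0 < d & forall y y', x < y < x + d -> x < y' < x + d -> P y -> P y'.
Proof.
move=> [p p0 hp]; have [d d0 hd] := root_isolated x p0; exists d => //.
have nr y y' z : x < y -> y' < x + d -> y <= z <= y' -> ~~ root p z.
  move=> xy yd /andP[yz zy]; apply/negP => /hd h.
  by have : z = x; [apply: h; rewrite ltr_norml; apply/andP; split; lra | lra].
move=> y y' /andP[xy yd] /andP[xy' yd']; have [yy|/ltW yy] := leP y y'.
- by move: (hp y y' yy (fun z => nr y y' z xy yd')); tauto.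
- by move: (hp y' y yy (fun z => nr y' y z xy' yd)); tauto.
Qed.

(** [Z] lists the roots of [p]; any other point has a neighbourhood free of roots, on which [P] is
    constant. *)
Lemma tame_nbhs P : tame P -> exists Z : seq R, forall t, t \notin Z ->
  exists2 d, 0 < d & forall y, `|y - t| < d -> P t -> P y.
Proof.
move=> [p p0 hp]; exists (rootsR p) => t tZ.
have [d d0 hd] := root_isolated t p0; exists d => // y yt.
have rt : ~~ root p t.
  by move: tZ; have := roots_on_rootsR p0 => /(_ t); rewrite in_itv /= => ->.
have nr u v z : `|u - t| < d -> `|v - t| < d -> u <= z <= v -> ~~ root p z.
  rewrite !ltr_norml => /andP[u1 u2] /andP[v1 v2] /andP[uz zv].
  apply/negP => rz; have : z = t; last by move=> zt; rewrite -zt rz in rt.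
  by apply: hd rz _; rewrite ltr_norml; apply/andP; split; lra.
have t0 : `|t - t| < d by rewrite subrr normr0.
have [ty|/ltW ty] := leP t y.
- by move: (hp t y ty (fun z => nr t y z t0 yt)); tauto.
- by move: (hp y t ty (fun z => nr y t z yt t0)); tauto.
Qed.

End Tame.

(** * Real and imaginary parts, squared modulus *)

Section ComplexParts.
Variable R : rcfType.
Implicit Types (x y : R) (z w : R[i]).
Local Open Scope complex_scope.

Lemma cReD z w : complex.Re (z + w) = complex.Re z + complex.Re w.
Proof. by case: z; case: w. Qed.
Lemma cImD z w : complex.Im (z + w) = complex.Im z + complex.Im w.
Proof. by case: z; case: w. Qed.
Lemma cReN z : complex.Re (- z) = - complex.Re z. Proof. by case: z. Qed.
Lemma cImN z : complex.Im (- z) = - complex.Im z. Proof. by case: z. Qed.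
Lemma cReM z w : complex.Re (z * w) =
  complex.Re z * complex.Re w - complex.Im z * complex.Im w.
Proof. by case: z; case: w. Qed.
Lemma cImM z w : complex.Im (z * w) =
  complex.Re z * complex.Im w + complex.Im z * complex.Re w.
Proof. by case: z; case: w. Qed.
Lemma cReJ z : complex.Re z^* = complex.Re z. Proof. by case: z. Qed.
Lemma cImJ z : complex.Im z^* = - complex.Im z. Proof. by case: z. Qed.
Lemma Re_sum (I : Type) (r : seq I) (P : pred I) (F : I -> R[i]) :
  complex.Re (\sum_(i <- r | P i) F i) = \sum_(i <- r | P i) complex.Re (F i).
Proof. by rewrite (big_morph _ cReD (erefl : complex.Re (0 : R[i]) = 0)). Qed.
Lemma Im_sum (I : Type) (r : seq I) (P : pred I) (F : I -> R[i]) :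
  complex.Im (\sum_(i <- r | P i) F i) = \sum_(i <- r | P i) complex.Im (F i).
Proof. by rewrite (big_morph _ cImD (erefl : complex.Im (0 : R[i]) = 0)). Qed.

Definition ReImE := (cReD, cImD, cReN, cImN, cReM, cImM, cReJ, cImJ).

Lemma complex_eq z w :
  complex.Re z = complex.Re w -> complex.Im z = complex.Im w -> z = w.
Proof. by case: z w => ? ? [? ?] /= -> ->. Qed.

Definition sqn z : R := complex.Re z ^+ 2 + complex.Im z ^+ 2.

Lemma sqn_ge0 z : 0 <= sqn z. Proof. by rewrite addr_ge0 // sqr_ge0. Qed.

Lemma sqn_eq0 z : (sqn z == 0) = (z == 0).
Proof. by rewrite paddr_eq0 ?sqr_ge0 // !sqrf_eq0 eq_complex. Qed.

Lemma sqnM z w : sqn (z * w) = sqn z * sqn w.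
Proof. by rewrite /sqn !ReImE; ring. Qed.

Lemma sqnN z : sqn (- z) = sqn z.
Proof. by rewrite /sqn !ReImE !sqrrN. Qed.

Lemma sqn_real x : sqn x%:C = x ^+ 2.
Proof. by rewrite /sqn /= expr0n addr0. Qed.

Lemma sqnV z : sqn z^-1 = (sqn z)^-1.
Proof.
have [->|z0] := eqVneq z 0; first by rewrite invr0 /sqn /= expr0n addr0 invr0.
have : sqn z * sqn z^-1 = 1 by rewrite -sqnM divff // /sqn /= expr1n expr0n addr0.
have s0 : sqn z != 0 by rewrite sqn_eq0.
by move=> h; rewrite -[RHS]mulr1 -[in RHS]h mulKf.
Qed.

Lemma Re_le_sqn z w : (complex.Re w - complex.Re z) ^+ 2 <= sqn (z - w).
Proof. by rewrite /sqn !ReImE -[leLHS]sqrrN opprB lerDl sqr_ge0. Qed.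

Lemma Im_le_sqn z w : (complex.Im w - complex.Im z) ^+ 2 <= sqn (z - w).
Proof. by rewrite /sqn !ReImE -[leLHS]sqrrN opprB lerDr sqr_ge0. Qed.

Lemma Im_invN z : complex.Im (- z^-1) = complex.Im z / sqn z.
Proof. by case: z => a b /=; rewrite opprK. Qed.

End ComplexParts.

(** * Existence of m-functions by a hyperbolic contraction *)

Lemma norm_le_sqr (R : realDomainType) (x y : R) :
  0 <= y -> x ^+ 2 <= y ^+ 2 -> `|x| <= y.
Proof. by move=> y0 xy; rewrite -ler_sqr ?nnegrE // real_normK ?num_real. Qed.

Section GeometricIncrements.
Variable R : realType.
Import numFieldNormedType.Exports.
Local Open Scope classical_set_scope.

Lemma cvg_geometric_increments (u : nat -> R) (K k : R) : 0 <= k -> k < 1 ->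
  (forall n, `|u n.+1 - u n| <= K * k ^+ n) -> cvgn u.
Proof.
move=> k0 k1 hu.
have : cvgn (series (telescope u)).
  apply: normed_cvg; apply: series_le_cvg (@is_cvg_geometric_series _ K k _).
  - by move=> n; exact: normr_ge0.
  - by move=> n; rewrite /geometric /= (le_trans _ (hu n)).
  - exact: hu.
  - by rewrite ger0_norm.
rewrite telescopeK => c; rewrite (_ : u = (fun n => u n - u 0%N + u 0%N)).
  exact: is_cvgD c (is_cvg_cst _).
by apply/funext => n; rewrite subrK.
Qed.

End GeometricIncrements.

Section Herglotz.
Variables (R : realType) (I : finType) (b : I -> R) (a : I -> I -> R).
Hypothesis a_ge0 : forall i j, 0 <= a i j.
Import numFieldNormedType.Exports.
Local Open Scope classical_set_scope.
Local Open Scope complex_scope.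
Implicit Types (z : R[i]) (m : I -> R[i]).

(** The fixed-point equation [m = - (z - b + sum a m)^-1], cleared of its denominator so that it is
    polynomial in the real and imaginary parts. *)
Definition herglotz z m := forall i, 0 < complex.Im (m i) /\
  m i * (z - (b i)%:C + \sum_j (a i j)%:C * m j) = -1.

Let den z m i := z - (b i)%:C + \sum_j (a i j)%:C * m j.
Let step z m i := - (den z m i)^-1.

Let Im_den z m i : complex.Im (den z m i) =
  complex.Im z + \sum_j a i j * complex.Im (m j).
Proof.
rewrite /den !ReImE /= subr0 Im_sum; congr (_ + _).
by apply: eq_bigr => j _; rewrite cImM /= mul0r addr0.
Qed.

Let Re_den z m i : complex.Re (den z m i) =
  complex.Re z - b i + \sum_j a i j * complex.Re (m j).
Proof.
rewrite /den !ReImE /= Re_sum; congr (_ + _).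
by apply: eq_bigr => j _; rewrite cReM /= mul0r subr0.
Qed.

(* [sqn (w - w') / (Im w * Im w')] is an increasing function of the hyperbolic
   distance; it is invariant under [w |-> - w^-1], and adding [i eps] decreases it
   by a definite factor as long as the imaginary parts are bounded. *)
Let close (r : R) m m' := forall i,
  sqn (m i - m' i) <= r * complex.Im (m i) * complex.Im (m' i).

(** Closeness survives addition: the cross term is bounded by Cauchy-Schwarz, and then by
    [2 sqrt (p q p' q') <= p q' + p' q]. *)
Lemma sqnD_le (r p q p' q' : R) (v v' : R[i]) : 0 <= r ->
  0 <= p -> 0 <= q -> 0 <= p' -> 0 <= q' ->
  sqn v <= r * p * q -> sqn v' <= r * p' * q' ->
  sqn (v + v') <= r * (p + p') * (q + q').
Proof.
move=> r0 p0 q0 p'0 q'0 hv hv'.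
set c := complex.Re v * complex.Re v' + complex.Im v * complex.Im v'.
have E : sqn (v + v') = sqn v + sqn v' + 2 * c by rewrite /sqn !ReImE /c; ring.
suff hc : 2 * c <= r * (p * q' + p' * q).
  have -> : r * (p + p') * (q + q') = r * p * q + r * p' * q' + r * (p * q' + p' * q).
    by ring.
  by rewrite E !lerD.
have t0 : 0 <= r * (p * q' + p' * q) by rewrite mulr_ge0 // addr_ge0 // mulr_ge0.
apply: le_trans (ler_norm _) (norm_le_sqr t0 _).
have h1 : c ^+ 2 <= sqn v * sqn v'.
  rewrite -subr_ge0 (_ : _ - _ =
    (complex.Re v * complex.Im v' - complex.Im v * complex.Re v') ^+ 2) ?sqr_ge0 //.
  by rewrite /sqn /c; ring.
have h2 : sqn v * sqn v' <= (r * p * q) * (r * p' * q').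
  by apply: ler_pM => //; exact: sqn_ge0.
rewrite exprMn; apply: le_trans (ler_wpM2l _ (le_trans h1 h2)) _ => //.
rewrite -subr_ge0 (_ : _ - _ = (r * (p * q' - p' * q)) ^+ 2) ?sqr_ge0 //.
by ring.
Qed.

(** The weighted sums stay close by [sqnD_le], with imaginary parts [P] and [Q]. Adding [z] keeps
    their difference and raises both parts by [eps]; as [X / (X + eps)] increases with [X], each
    part gains a factor at most [C / (C + eps)]. *)
Let step_contracts (eps C r t : R) m m' : 0 < eps -> 0 <= r ->
  (forall i, 0 < complex.Im (m i)) -> (forall i, 0 < complex.Im (m' i)) ->
  (forall i, \sum_j a i j * complex.Im (m j) <= C) ->
  (forall i, \sum_j a i j * complex.Im (m' j) <= C) ->
  close r m m' ->
  close ((C / (C + eps)) ^+ 2 * r) (step (t +i* eps) m) (step (t +i* eps) m').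
Proof.
move=> e0 r0 m0 m'0 mC m'C cl i; set z := t +i* eps.
set P := \sum_j a i j * complex.Im (m j).
set Q := \sum_j a i j * complex.Im (m' j).
have P0 : 0 <= P by apply: sumr_ge0 => j _; rewrite mulr_ge0 // ltW.
have Q0 : 0 <= Q by apply: sumr_ge0 => j _; rewrite mulr_ge0 // ltW.
have PC : P <= C := mC i.
have QC : Q <= C := m'C i.
have hw : sqn (den z m i - den z m' i) <= r * P * Q.
  have -> : den z m i - den z m' i = \sum_j (a i j)%:C * (m j - m' j).
    rewrite /den; under [RHS]eq_bigr do rewrite mulrBr.
    by rewrite sumrB; ring.
  suff [] : [/\ 0 <= P, 0 <= Q & sqn (\sum_j (a i j)%:C * (m j - m' j)) <= r * P * Q] by [].
  rewrite /P /Q; elim/big_ind3 : _ => [|p p' v q' q w|j _].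
  - by split=> //; rewrite /sqn /= expr0n addr0 !mulr0.
  - by move=> [p0 p'0 hv] [q0 q'0 hw]; split; rewrite ?addr_ge0 //; apply: sqnD_le.
  - split; try by rewrite mulr_ge0 // ltW.
    rewrite sqnM sqn_real (_ : _ * _ * _ = a i j ^+ 2 *
      (r * complex.Im (m j) * complex.Im (m' j))); last by ring.
    by rewrite ler_wpM2l // sqr_ge0.
have C0 : 0 <= C := le_trans P0 PC.
have Ce : 0 < C + eps by rewrite ltr_wpDl.
set k := C / (C + eps).
have k0 : 0 <= k by rewrite divr_ge0 // ltW.
have lek X : 0 <= X -> X <= C -> X <= k * (X + eps).
  move=> X0 XC; rewrite /k mulrAC ler_pdivlMr //; nra.
have Iw n : complex.Im (den z n i) = eps + \sum_j a i j * complex.Im (n j).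
  by rewrite Im_den.
have w0 : 0 < sqn (den z m i).
  rewrite lt_neqAle sqn_ge0 andbT eq_sym sqn_eq0; apply/negP => /eqP w0.
  by have := Iw m; rewrite w0 -/P /=; lra.
have w'0 : 0 < sqn (den z m' i).
  rewrite lt_neqAle sqn_ge0 andbT eq_sym sqn_eq0; apply/negP => /eqP w'0.
  by have := Iw m'; rewrite w'0 -/Q /=; lra.
rewrite /step !Im_invN !Iw -/P -/Q.
have -> : - (den z m i)^-1 - - (den z m' i)^-1 =
    (den z m i - den z m' i) * ((den z m i)^-1 * (den z m' i)^-1).
  by field; rewrite -!sqn_eq0 !gt_eqF.
rewrite !sqnM !sqnV.
rewrite (_ : _ * _ * _ = k ^+ 2 * r * (eps + P) * (eps + Q) *
  ((sqn (den z m i))^-1 * (sqn (den z m' i))^-1)); last by ring.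
rewrite ler_pM2r ?mulr_gt0 ?invr_gt0 //; apply: le_trans hw _.
rewrite (_ : k ^+ 2 * _ * _ * _ = r * (k * (P + eps)) * (k * (Q + eps))); last by ring.
apply: ler_pM; rewrite ?mulr_ge0 //; last exact: lek.
by rewrite ler_wpM2l // lek.
Qed.


Lemma herglotz_exists (t eps : R) : 0 < eps -> exists m, herglotz (t +i* eps) m.
Proof.
move=> e0; set z := t +i* eps.
(* The start [i / eps] obeys the a priori bound [Im <= eps^-1], which the iteration preserves
   because every denominator has imaginary part at least [eps]. *)
pose M n := iter n (step z) (fun=> 0 +i* eps^-1).
have Iden m i : (forall j, 0 < complex.Im (m j)) -> eps <= complex.Im (den z m i).
  by move=> m0; rewrite Im_den lerDl sumr_ge0 // => j _; rewrite mulr_ge0 // ltW.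
have sden m i : (forall j, 0 < complex.Im (m j)) ->
    eps * complex.Im (den z m i) <= sqn (den z m i).
  move=> m0; have := Iden m i m0; set y := complex.Im _ => ey.
  by rewrite /sqn -/y; have := sqr_ge0 (complex.Re (den z m i)); nra.
have M0 n : forall i, 0 < complex.Im (M n i) /\ complex.Im (M n i) <= eps^-1.
  elim: n => [|n IH] i /=; first by rewrite invr_gt0.
  have mp j : 0 < complex.Im (M n j) by case: (IH j).
  have ey := Iden _ i mp; have es := sden _ i mp.
  rewrite /step Im_invN; set y := complex.Im _ in ey es *.
  have y0 : 0 < y by lra.
  have s0 : 0 < sqn (den z (M n) i) by apply: lt_le_trans es; rewrite mulr_gt0.
  by rewrite divr_gt0 // ler_pdivrMr // ler_pdivlMl.
pose C := (\sum_i \sum_j a i j) / eps.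
have MC n i : \sum_j a i j * complex.Im (M n j) <= C.
  apply: (@le_trans _ _ (\sum_j a i j * eps^-1)).
    by apply: ler_sum => j _; rewrite ler_wpM2l //; case: (M0 n j).
  rewrite -mulr_suml /C ler_wpM2r ?invr_ge0 ?(ltW e0) // [leRHS](bigD1 i) //= lerDl.
  by apply: sumr_ge0 => k _; apply: sumr_ge0.
have C0 : 0 <= C.
  by rewrite divr_ge0 ?(ltW e0) //; apply: sumr_ge0 => k _; apply: sumr_ge0.
pose k := C / (C + eps).
have k0 : 0 <= k by rewrite divr_ge0 // addr_ge0 // ltW.
have k1 : k < 1 by rewrite ltr_pdivrMr ?mul1r ?ltrDl // ltr_wpDl.
(* [q i] is the exact closeness of the first two iterates at [i]; the sum over [i] is a closeness
   constant common to all indices. *)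
pose q i := sqn (M 0 i - M 1%N i) / (complex.Im (M 0 i) * complex.Im (M 1%N i)).
have q0 i : 0 <= q i.
  rewrite divr_ge0 ?sqn_ge0 // mulr_ge0 // ltW //;
    [by case: (M0 0 i) | by case: (M0 1%N i)].
have cl n : close ((k ^+ n) ^+ 2 * \sum_i q i) (M n) (M n.+1).
  elim: n => [|n IH].
    move=> i; rewrite expr0 expr1n mul1r -mulrA.
    have p0 : 0 < complex.Im (M 0 i) * complex.Im (M 1%N i).
      by rewrite mulr_gt0 //; [case: (M0 0 i) | case: (M0 1%N i)].
    rewrite -ler_pdivrMr // -/(q i) (bigD1 i) //= lerDl.
    exact: sumr_ge0.
  have -> : (k ^+ n.+1) ^+ 2 * (\sum_i q i) = k ^+ 2 * ((k ^+ n) ^+ 2 * \sum_i q i).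
    by rewrite [k ^+ n.+1]exprS; ring.
  have r0 : 0 <= (k ^+ n) ^+ 2 * \sum_i q i by rewrite mulr_ge0 ?sqr_ge0 // sumr_ge0.
  have p1 i : 0 < complex.Im (M n i) by case: (M0 n i).
  have p2 i : 0 < complex.Im (M n.+1 i) by case: (M0 n.+1 i).
  exact: (step_contracts _ e0 r0 p1 p2 (MC n) (MC n.+1) IH).
(* Since imaginary parts are at most [eps^-1], closeness [k^(2n) sum q] yields Euclidean increments
   at most [K k^n]. *)
pose K := Num.sqrt (\sum_i q i) / eps.
have K0 : 0 <= K by rewrite divr_ge0 ?sqrtr_ge0 // ltW.
have sq n i : sqn (M n i - M n.+1 i) <= (K * k ^+ n) ^+ 2.
  apply: le_trans (cl n i) _.
  have [p0 pe] := M0 n i; have [p0' pe'] := M0 n.+1 i.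
  rewrite -mulrA (_ : (K * k ^+ n) ^+ 2 =
      (k ^+ n) ^+ 2 * (\sum_i q i) * (eps^-1 * eps^-1)).
    rewrite ler_wpM2l //; first by rewrite mulr_ge0 ?sqr_ge0 // sumr_ge0.
    by apply: ler_pM => //; exact: ltW.
  rewrite /K !exprMn sqr_sqrtr ?sumr_ge0 //; ring.
have cR i : cvgn (fun n => complex.Re (M n i)).
  apply: (@cvg_geometric_increments _ _ K k) => // n.
  apply: norm_le_sqr; first by rewrite mulr_ge0 // exprn_ge0.
  exact: le_trans (Re_le_sqn _ _) (sq n i).
have cI i : cvgn (fun n => complex.Im (M n i)).
  apply: (@cvg_geometric_increments _ _ K k) => // n.
  apply: norm_le_sqr; first by rewrite mulr_ge0 // exprn_ge0.
  exact: le_trans (Im_le_sqn _ _) (sq n i).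
pose m i := limn (fun n => complex.Re (M n i)) +i* limn (fun n => complex.Im (M n i)).
have mI0 i : 0 <= complex.Im (m i).
  apply: limr_ge; first exact: cI.
  by near=> n; apply: ltW; case: (M0 n i).
have eqM n i : M n.+1 i * den z (M n) i = -1.
  rewrite /= /step mulNr mulVf // -sqn_eq0 gt_eqF //.
  have mp j : 0 < complex.Im (M n j) by case: (M0 n j).
  by apply: lt_le_trans (sden _ i mp); rewrite mulr_gt0 // (lt_le_trans e0) // Iden.
have cvgR i : (fun n => complex.Re (den z (M n) i)) @ \oo --> complex.Re (den z m i).
  rewrite Re_den; under eq_fun do rewrite Re_den.
  apply: cvgD; first exact: cvg_cst.
  apply: cvg_big => [|j _]; [exact: add_continuous|apply: cvgM]; [exact: cvg_cst | exact: cR].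
have cvgI i : (fun n => complex.Im (den z (M n) i)) @ \oo --> complex.Im (den z m i).
  rewrite Im_den; under eq_fun do rewrite Im_den.
  apply: cvgD; first exact: cvg_cst.
  apply: cvg_big => [|j _]; [exact: add_continuous|apply: cvgM]; [exact: cvg_cst | exact: cI].
have cR1 i : (fun n => complex.Re (M n.+1 i)) @ \oo --> complex.Re (m i).
  by rewrite (cvg_shiftS (fun n => complex.Re (M n i))); exact: cR.
have cI1 i : (fun n => complex.Im (M n.+1 i)) @ \oo --> complex.Im (m i).
  by rewrite (cvg_shiftS (fun n => complex.Im (M n i))); exact: cI.
have eqm i : m i * den z m i = -1.
  apply: complex_eq.
    have h : (fun n => complex.Re (M n.+1 i * den z (M n) i)) @ \oo -->
        complex.Re (m i * den z m i).
      rewrite cReM; under eq_fun do rewrite cReM.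
      by apply: cvgB; apply: cvgM.
    by rewrite -(cvg_lim _ h) //; under eq_fun do rewrite eqM; rewrite lim_cst.
  have h : (fun n => complex.Im (M n.+1 i * den z (M n) i)) @ \oo -->
      complex.Im (m i * den z m i).
    rewrite cImM; under eq_fun do rewrite cImM.
    by apply: cvgD; apply: cvgM.
  by rewrite -(cvg_lim _ h) //; under eq_fun do rewrite eqM; rewrite lim_cst.
exists m => i; split; last exact: eqm.
(* The limit only gives [Im m >= 0]; strictness is recovered from the equation, whose denominator
   has imaginary part at least [eps]. *)
have d0 : 0 < complex.Im (den z m i).
  rewrite Im_den (lt_le_trans e0) // lerDl sumr_ge0 // => j _.
  by rewrite mulr_ge0.
have dn0 : den z m i != 0.
  by apply/eqP => dz; rewrite dz ltxx in d0.
have -> : m i = - (den z m i)^-1.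
  by apply: (mulIf dn0); rewrite eqm mulNr mulVf.
by rewrite Im_invN divr_gt0 // lt_neqAle sqn_ge0 andbT eq_sym sqn_eq0.
Unshelve. all: by end_near.
Qed.

End Herglotz.

(** * Definability of the points where Im m is unbounded *)

Lemma definable_iff (R : rcfType) (S S' : seq R -> Prop) :
  (forall e, S e <-> S' e) -> definable S -> definable S'.
Proof. by move=> SS' [f Ef]; exists f => e; rewrite Ef. Qed.

Section Unbounded.
Variables (R : realType) (I : finType) (b : I -> R) (a : I -> I -> R).
Local Open Scope complex_scope.

(** The existential over all solutions keeps the condition first order; its failure bounds every
    solution at once. *)
Definition herglotz_above i (t eps M : R) :=
  exists m, herglotz b a (t +i* eps) m /\ M < complex.Im (m i).

(** This is limsup Im m = +oo as [eps -> 0], written with quantifiers over real numbers only. *)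
Definition herglotz_unbounded i t := forall M d, 0 < d ->
  exists eps, 0 < eps < d /\ herglotz_above i t eps M.

(* An environment lists [t], [M], [d], [eps], followed by the real parts and then
   the imaginary parts of the unknowns. *)
Let N := #|I|.
Let X (e : seq R) (i : I) := e`_(4 + enum_rank i).
Let Y (e : seq R) (i : I) := e`_(4 + N + enum_rank i).
Let WR e i := e`_0 - b i + \sum_j a i j * X e j.
Let WI e i := e`_3 + \sum_j a i j * Y e j.

Let real_herglotz (e : seq R) := forall i, 0 < Y e i /\
  (X e i * WR e i - Y e i * WI e i = -1 /\ X e i * WI e i + Y e i * WR e i = 0).

Let real_herglotzP e : real_herglotz e <->
  herglotz b a (e`_0 +i* e`_3) (fun i => X e i +i* Y e i).
Proof.
have E i : e`_0 +i* e`_3 - (b i)%:C + \sum_j (a i j)%:C * (X e j +i* Y e j)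
    = WR e i +i* WI e i.
  apply: complex_eq; rewrite !ReImE ?Re_sum ?Im_sum /= ?subr0; congr (_ + _);
    by apply: eq_bigr => j _; rewrite mul0r ?subr0 ?addr0.
split=> h i; have := h i; rewrite E /=.
  by move=> [-> [h1 h2]]; split=> //; apply: complex_eq; rewrite /= ?h1 ?h2 ?oppr0.
by move=> [-> [-> ->]]; rewrite oppr0.
Qed.

Let definable_real_herglotz : definable real_herglotz.
Proof.
apply: definable_all => i.
have dX j : term_fun (X ^~ j) by exact: term_fun_var.
have dY j : term_fun (Y ^~ j) by exact: term_fun_var.
have dR : term_fun (WR ^~ i).
  apply: term_funD; first exact: term_funD (term_fun_var _ _) (term_fun_const _).
  by apply: term_fun_sum => j; apply: term_funM => //; exact: term_fun_const.
have dI : term_fun (WI ^~ i).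
  apply: term_funD; first exact: term_fun_var.
  by apply: term_fun_sum => j; apply: term_funM => //; exact: term_fun_const.
apply: definable_and; first by apply: definable_lt => //; exact: term_fun_const.
apply: definable_and; apply: definable_eq; try exact: term_fun_const.
  by apply: term_funD; [|apply: term_funN]; exact: term_funM.
by apply: term_funD; exact: term_funM.
Qed.

Lemma definable_herglotz_above i :
  definable (fun e => herglotz_above i e`_0 e`_3 e`_1).
Proof.
have d1 : definable (fun e => real_herglotz e /\ e`_1 < Y e i).
  by apply: definable_and => //; apply: definable_lt; exact: term_fun_var.
apply: definable_iff (definable_exists_block 4 (N + N) d1) => e; split.
  move=> [e' [ee' [/real_herglotzP h1 h2]]].
  exists (fun i => X e' i +i* Y e' i); split; last by rewrite /= -ee'.
  by rewrite -!ee'.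
move=> [m [hm Mm]].
(* Only the block of unknowns is overwritten; entries of [e] beyond it are copied, and the length is
   enough for both the block and [e]. *)
pose e' := mkseq (fun k => if (k < 4)%N then e`_k
  else if (k < 4 + N)%N then (nth 0 [seq complex.Re (m i) | i <- enum I] (k - 4))
  else if (k < 4 + (N + N))%N then
    (nth 0 [seq complex.Im (m i) | i <- enum I] (k - (4 + N))) else e`_k)
  (maxn (size e) (4 + (N + N))).
have e'E k : ~~ (4 <= k < 4 + (N + N))%N -> e'`_k = e`_k.
  move=> hk; have [kl|kl] := ltnP k (maxn (size e) (4 + (N + N))).
    rewrite /e' nth_mkseq //; case: ltnP => // k4; rewrite k4 /= -leqNgt in hk.
    rewrite (leq_gtF hk) (@leq_gtF (4 + N)) //.
    by apply: leq_trans hk; rewrite leq_add2l leq_addr.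
  by rewrite !nth_default // ?size_mkseq //; apply: leq_trans kl; rewrite leq_maxl.
have EX j : X e' j = complex.Re (m j).
  have hj := ltn_ord (enum_rank j); rewrite -[#|_|]/N in hj.
  rewrite /X /e' nth_mkseq; last first.
    by apply: leq_trans (leq_maxr _ _); rewrite ltn_add2l ltn_addr.
  rewrite (leq_gtF (leq_addr _ _)) ltn_add2l hj addKn (nth_map j) ?nth_enum_rank //.
  by rewrite -cardE.
have EY j : Y e' j = complex.Im (m j).
  have hj := ltn_ord (enum_rank j); rewrite -[#|_|]/N in hj.
  rewrite /Y /e' nth_mkseq; last first.
    by apply: leq_trans (leq_maxr _ _); rewrite -addnA !ltn_add2l.
  rewrite -addnA (leq_gtF (leq_addr _ _)) addnA (leq_gtF (leq_addr _ _)).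
  rewrite -addnA !ltn_add2l hj.
  rewrite addnA addKn (nth_map j) ?nth_enum_rank //.
  by rewrite -cardE.
exists e'; split=> //; split; last by rewrite EY e'E.
apply/real_herglotzP; rewrite !e'E //.
rewrite (_ : (fun i => _) = m) //; apply/funext => j.
by rewrite EX EY; case: (m j).
Qed.

(** Tameness in [t] spreads unboundedness to a neighbourhood; tameness in [eps], at fixed [s] and
    [M], turns limsup into a limit. Finiteness of [I] gives a common [Z]. *)
Lemma herglotz_unbounded_nbhs : exists Z : seq R, forall i t, t \notin Z ->
  herglotz_unbounded i t -> exists2 d, 0 < d & forall s, `|s - t| < d ->
    forall M, exists2 d', 0 < d' & forall eps, 0 < eps < d' -> herglotz_above i s eps M.
Proof.
have tameU i : tame (herglotz_unbounded i).
  have d1 : definable (fun e => (0 < e`_3 /\ e`_3 < e`_2) /\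
      herglotz_above i e`_0 e`_3 e`_1).
    apply: definable_and; last exact: definable_herglotz_above.
    by apply: definable_and; apply: definable_lt;
      (exact: term_fun_const || exact: term_fun_var).
  have d2 : definable (fun e : seq R => 0 < e`_2).
    by apply: definable_lt; [exact: term_fun_const|exact: term_fun_var].
  have dU := definable_forall 1
    (definable_forall 2 (definable_imp d2 (definable_exists 3 d1))).
  apply: tame_ext (definable_tame [::] 0 dU) => t; split.
    by move=> h M d d0; have [eps [[e0 ed] hh]] := h M d d0; exists eps; rewrite e0 ed.
  move=> h M d d0; have [eps [/andP[e0 ed] hh]] := h M d d0.
  by exists eps.
have tameA i t M : tame (fun eps => herglotz_above i t eps M).
  (* The 0 fills the slot of [d], which this predicate does not read. *)
  apply: tame_ext (definable_tame [:: t; M; 0] 3 (definable_herglotz_above i)) => eps.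
  by [].
have /boolp.choice[Z hZ] := fun i => tame_nbhs (tameU i).
exists (flatten [seq Z i | i <- enum I]) => i t tZ ut.
have [|d d0 hd] := hZ i t.
  by apply: contra tZ => tZ; apply/flatten_mapP; exists i; rewrite ?mem_enum.
exists d => // s /hd/(_ ut) us M.
have [d' d'0 hd'] := tame_right 0 (tameA i s M); exists d' => // eps eps0.
have [e1 [e1d h1]] := us M d' d'0.
by apply: hd' h1; rewrite add0r.
Qed.

End Unbounded.

(** * Null sets on which a measure has bounded upper density *)

Section BoundedDensity.
Variable R : realType.
Import numFieldNormedType.Exports.
Local Open Scope classical_set_scope.
Local Open Scope ereal_scope.
Implicit Types (mu : {measure set (measurableTypeR R) -> \bar R}).

Lemma archi_inv_lt (e M : R) : (0 < e)%R ->
  exists n : nat, (n.+1%:R^-1 < e)%R /\ (M <= n%:R)%R.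
Proof.
move=> e0; exists (maxn (Num.trunc M).+1 (Num.trunc e^-1)); split; last first.
  by rewrite (le_trans (ltW (truncnS_gt _))) // ler_nat leq_maxl.
rewrite -[ltRHS]invrK ltf_pV2 ?posrE ?invr_gt0 //; apply: lt_le_trans (truncnS_gt _) _.
by rewrite ler_nat ltnS leq_maxr.
Qed.

Lemma negligible_small d (T : measurableType d) (mu : {measure set T -> \bar R})
    (S : set T) :
  (forall e : R, (0 < e)%R -> exists A, [/\ measurable A, S `<=` A & mu A <= e%:E]) ->
  mu.-negligible S.
Proof.
move=> h.
have inv0 k : (0 < k.+1%:R^-1 :> R)%R by rewrite invr_gt0.
have /boolp.choice[A hA] := fun k => h _ (inv0 k).
have mA : measurable (\bigcap_k A k) by apply: bigcapT_measurable => k; case: (hA k).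
exists (\bigcap_k A k); split => //; last by move=> t St k _; case: (hA k) => _ /(_ t St).
apply/eqP; rewrite eq_le measure_ge0 andbT.
apply/lee_addgt0Pr => e e0; rewrite add0e.
have [k [ke _]] := archi_inv_lt 0 e0.
apply: le_trans (_ : mu (A k) <= _).
  by apply: le_measure; rewrite ?inE //; [case: (hA k)|exact: bigcap_inf].
by have [_ _ /le_trans] := hA k; apply; rewrite lee_fin ltW.
Qed.

Lemma null_open_cover (N : set R) (e : R) :
  measurable N -> lebesgue_measure N = 0 -> (0 < e)%R ->
  exists ab : nat -> R * R, [/\ N `<=` \bigcup_k `](ab k).1, (ab k).2[,
    forall k, ((ab k).1 < (ab k).2)%R &
    \sum_(k <oo) ((ab k).2 - (ab k).1)%:E <= e%:E].
Proof.
move=> mN N0 e0.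
have N0' : (@lebesgue_measure R).-negligible N by exact/negligibleP.
have := (negligible_outer_measure N).1 N0'; rewrite outer_measure_open_itv_cover => h.
have : (ereal_inf [set \sum_(k <oo) wlength idfun (F k) | F in open_itv_cover N])
   < (e / 2)%:E by rewrite h lte_fin divr_gt0.
move=> /ereal_inf_lt[_ [F [Fi NF] <-] Fe].
have /boolp.choice[ab hab] := Fi.
pose d k : R := (e / 2 / (2 ^ k.+1)%:R)%R.
have d0 k : (0 < d k)%R by rewrite !divr_gt0 // ltr0n expn_gt0.
(* Empty covering intervals are replaced by intervals of length [d k], of total length at most
   [e / 2], so that every length is positive. *)
exists (fun k => if ((ab k).1 < (ab k).2)%R then ab k else (0, d k)%R); split.
- move=> t /NF[k _]; rewrite hab /= in_itv /= => /andP[at_ tb].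
  by exists k => //=; rewrite in_itv (lt_trans at_ tb) /= at_ tb.
- by move=> k; case: ifPn => //= _; exact: d0.
- apply: (@le_trans _ _ (\sum_(k <oo) (wlength idfun (F k) + (d k)%:E))).
    apply: lee_nneseries => [k _ _|k _].
      by rewrite lee_fin subr_ge0; case: ifPn => [/ltW //|_ /=]; exact: ltW.
    rewrite hab wlength_itv /= lte_fin; case: ifPn => [ab1|ab1] /=.
      by rewrite EFinB; apply: leeDl; rewrite lee_fin ltW.
    by rewrite add0e subr0.
  apply: le_trans (epsilon_trick _ _ _) _; [|by rewrite divr_ge0 // ltW|].
    by move=> k; exact: wlength_ge0.
  by rewrite [in leRHS](splitr e) EFinD leeD // ltW.
Qed.

(** [N] is the union of sets [S n] with a uniform constant and scale; they need not be measurable,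
    hence the passage through negligible sets. A short covering interval of length [l] that meets
    [S n] at [t] lies in []t - l, t + l[], so its mass is at most [l n]. *)
Lemma null_set_bounded_density mu (N : set R) :
  measurable N -> lebesgue_measure N = 0 ->
  (forall t, N t -> exists M d : R, (0 < d)%R /\ forall eps, (0 < eps < d)%R ->
    mu `](t - eps)%R, (t + eps)%R[ <= (eps * M)%:E) ->
  mu N = 0.
Proof.
move=> mN N0 hN.
pose S n := [set t | N t /\ forall eps, (0 < eps < n.+1%:R^-1)%R ->
  mu `](t - eps)%R, (t + eps)%R[ <= (eps * n%:R)%:E].
suff hS n : mu.-negligible (S n).
  apply/negligibleP => //; apply: negligibleS (negligible_bigcup hS) => t Nt.
  have [M [d [d0 h]]] := hN t Nt.
  have [n [nd Mn]] := archi_inv_lt M d0.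
  exists n => //; split => // eps /andP[e0 en].
  have ed : (0 < eps < d)%R by rewrite e0 (lt_trans en).
  apply: le_trans (h eps ed) _; rewrite lee_fin ler_pM2l //.
apply: negligible_small => e e0.
(* The first bound keeps each covering interval shorter than the scale of [S n]; the second makes
   the total mass [n e'] at most [e]. *)
pose e' := Num.min (n.+1%:R^-1 / 2)%R (e / n.+1%:R)%R.
have e'0 : (0 < e')%R by rewrite lt_min !divr_gt0 // invr_gt0.
have [ab [Nab ablt abe]] := null_open_cover mN N0 e'0.
(* Intervals that miss [S n] are dropped, since nothing bounds their mass. *)
pose G k := if `[< `](ab k).1, (ab k).2[ `&` S n !=set0 >]
  then `](ab k).1, (ab k).2[%classic else set0.
have mG k : measurable (G k) by rewrite /G; case: ifP.
exists (\bigcup_k G k); split.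
- exact: bigcupT_measurable.
- move=> t St; have [k _ tk] := Nab t St.1; exists k => //.
  by rewrite /G ifT //; apply/asboolP; exists t.
- apply: (@le_trans _ _ (\sum_(k <oo) mu (G k))).
    apply: measure_sigma_subadditive => //; exact: bigcupT_measurable.
  apply: (@le_trans _ _ (\sum_(k <oo) (n%:R)%:E * ((ab k).2 - (ab k).1)%:E)).
    apply: lee_nneseries => // k _.
    rewrite /G; case: ifPn => [/asboolP[t [/= tk St]]|_]; last first.
      by rewrite measure0 -EFinM lee_fin mulr_ge0 // subr_ge0 ltW.
    have lk : ((ab k).2 - (ab k).1 <= e')%R.
      rewrite -lee_fin; apply: le_trans abe.
      rewrite (@nneseriesD1 _ _ k) //.
        by rewrite leeDl // nneseries_ge0 // => i _ _; rewrite lee_fin subr_ge0 ltW.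
      by move=> i _; rewrite lee_fin subr_ge0 ltW.
    have l0 : (0 < (ab k).2 - (ab k).1)%R by rewrite subr_gt0.
    have ln : (0 < (ab k).2 - (ab k).1 < n.+1%:R^-1)%R.
      rewrite l0 (le_lt_trans lk) // gt_min; apply/orP; left.
      by rewrite ltr_pdivrMr // ltr_pMr ?invr_gt0 // ltr1n.
    have := St.2 _ ln; rewrite mulrC EFinM; apply: le_trans.
    apply: le_measure; rewrite ?inE //; move=> s /=.
    move: tk; rewrite !in_itv /= => /andP[t1 t2] /andP[s1 s2].
    apply/andP; split; lra.
  rewrite nneseriesZl; last by move=> i _; rewrite lee_fin subr_ge0 ltW.
  apply: (@le_trans _ _ (n%:R%:E * e'%:E)).
    by rewrite lee_wpmul2l // lee_fin.
  rewrite -EFinM lee_fin.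
  apply: (@le_trans _ _ (n%:R * (e / n.+1%:R))%R).
    by rewrite ler_wpM2l // ge_min lexx orbT.
  rewrite mulrA ler_pdivrMr // mulrC ler_pM2l // ler_nat; exact: leqnSn.
Qed.

End BoundedDensity.

(** * The Poisson kernel and Fatou's lemma *)

Section Poisson.
Variable R : realType.
Import numFieldNormedType.Exports.
Local Open Scope classical_set_scope.

(** The Poisson kernel of the upper half-plane times [pi], that is, Im (s - z)^-1 with
    [z = t + i eps]. *)
Definition poisson (eps t s : R) : R := eps / ((s - t) ^+ 2 + eps ^+ 2).

Lemma poisson_den_gt0 (eps t s : R) : 0 < eps -> 0 < (s - t) ^+ 2 + eps ^+ 2.
Proof. by move=> e0; rewrite ltr_wpDl ?sqr_ge0 // exprn_gt0. Qed.

Lemma poisson_ge0 (eps t s : R) : 0 < eps -> 0 <= poisson eps t s.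
Proof. by move=> e0; rewrite divr_ge0 // ltW // poisson_den_gt0. Qed.

Lemma is_derive_atan_poisson (eps s t : R) : 0 < eps ->
  is_derive t 1 (fun t => atan ((t - s) / eps)) (poisson eps t s).
Proof.
move=> e0; have en0 : eps != 0 by rewrite gt_eqF.
have h : is_derive t 1 (fun t => (t - s) / eps) (eps^-1).
  rewrite (_ : (fun t => _) = (fun t => eps^-1 *: (t - s))); last first.
    by apply/funext => x; rewrite /= mulrC.
  by apply: is_derive_eq; rewrite subr0; exact: mulr1.
have k := @is_derive1_comp _ _ (fun t => (t - s) / eps) _ _ _
  (is_derive1_atan ((t - s) / eps)) h.
apply: (is_derive_eq k); rewrite /poisson.
have := poisson_den_gt0 t s e0 => d0.
have d1 : 1 + ((t - s) / eps) ^+ 2 != 0.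
  by rewrite gt_eqF // ltr_wpDr ?sqr_ge0.
have E : 1 + ((t - s) / eps) ^+ 2 = ((s - t) ^+ 2 + eps ^+ 2) / eps ^+ 2.
  by field.
rewrite [LHS]mulrC E; field; rewrite en0 gt_eqF //.
Qed.

Lemma continuous_poisson (eps s : R) : 0 < eps -> continuous (fun t => poisson eps t s).
Proof.
move=> e0 t; apply: cvgM; first exact: cvg_cst.
apply: cvgV; first by rewrite gt_eqF // poisson_den_gt0.
apply: cvgD; last exact: cvg_cst.
under eq_fun do rewrite expr2; rewrite expr2.
by apply: cvgM; apply: cvgB; (exact: cvg_cst || exact: cvg_id).
Qed.

(** An arctangent is a primitive in [t], and its total variation is at most [pi]. *)
Lemma integral_poisson_le (eps s a b : R) : 0 < eps -> a < b ->
  (\int[@lebesgue_measure R]_(t in `[a, b]) (poisson eps t s)%:E <= (pi : R)%:E)%E.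
Proof.
move=> e0 ab; have en0 : eps != 0 by rewrite gt_eqF.
have dF t : derivable (fun t => atan ((t - s) / eps)) t 1.
  by have [] := is_derive_atan_poisson s t e0.
rewrite (@continuous_FTC2 _ _ (fun t => atan ((t - s) / eps))) //.
- rewrite -EFinB lee_fin.
  by have := atan_ltpi2 ((b - s) / eps); have := atan_gtNpi2 ((a - s) / eps); lra.
- by apply: continuous_subspaceT; exact: continuous_poisson.
- have cF t : {for t, continuous (fun t => atan ((t - s) / eps))}.
    by apply: differentiable_continuous; apply/derivable1_diffP.
  split; first by move=> t _.
    by apply: cvg_at_right_filter; exact: cF.
  by apply: cvg_at_left_filter; exact: cF.
- by move=> t _; rewrite derive1E; have [] := is_derive_atan_poisson s t e0.
Qed.

End Poisson.

Section FinitePart.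
Context d (T : measurableType d) (R : realType).
Variable mu : {measure set T -> \bar R}.
Hypothesis mu_fin : (mu setT < +oo)%E.

Let fin_num_mu : fin_num_fun mu.
Proof.
move=> A mA; rewrite ge0_fin_numE //; apply: le_lt_trans mu_fin.
by apply: le_measure; rewrite ?inE.
Qed.

(* The idle [let] makes the finiteness hypothesis a parameter of [as_finite], to
   which a finite measure structure can then be attached. *)
Definition as_finite : set T -> \bar R := let _ := fin_num_mu in mu.
HB.instance Definition _ := Measure.on as_finite.
HB.instance Definition _ := Measure_isFinite.Build _ _ _ as_finite fin_num_mu.

End FinitePart.

Section PoissonBlowup.
Variable R : realType.
Import numFieldNormedType.Exports.
Local Open Scope classical_set_scope.
Local Open Scope ereal_scope.
Variable mu : {measure set (measurableTypeR R) -> \bar R}.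
Hypothesis mu_fin : mu setT < +oo.

Let leb : {measure set (measurableTypeR R) -> \bar R} := @lebesgue_measure R.

Lemma measurable_poisson_fst (eps t : R) : (0 < eps)%R ->
  measurable_fun [set: measurableTypeR R] (poisson eps t).
Proof.
move=> e0; apply: continuous_measurable_fun => s.
rewrite (_ : poisson eps t = fun s => poisson eps s t).
  exact: continuous_poisson.
by apply/funext => u; rewrite /poisson -sqrrN opprB.
Qed.

Let f (a b eps : R) (z : measurableTypeR R * measurableTypeR R) : \bar R :=
  (\1_(`[a, b]%classic : set R) z.1 * poisson eps z.1 z.2)%:E.

Let mf (a b eps : R) : (0 < eps)%R -> measurable_fun setT (f a b eps).
Proof.
move=> e0; apply/measurable_EFinP; apply: measurable_funM.
  by apply: measurableT_comp; first exact: measurable_indic.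
rewrite (_ : (fun z => _) = poisson eps 0 \o
    (fun z : measurableTypeR R * measurableTypeR R => (z.2 - z.1)%R)); last first.
  by apply/funext => z; rewrite /poisson /= subr0.
apply: measurableT_comp; first exact: measurable_poisson_fst.
by apply: measurable_funB.
Qed.

Let f0 (a b eps : R) z : (0 < eps)%R -> 0 <= f a b eps z.
Proof. by move=> e0; rewrite lee_fin mulr_ge0 // poisson_ge0. Qed.

Let F (a b eps t : R) := \int[as_finite mu_fin]_s f a b eps (t, s).

(** Tonelli lets [t] be integrated first, where the kernel has mass at most [pi] for each [s]. *)
Let integral_F_le (a b eps : R) : (a < b)%R -> (0 < eps)%R ->
  \int[leb]_t F a b eps t <= pi%:E * mu setT.
Proof.
move=> ab e0; rewrite /F.
rewrite (fubini_tonelli (f a b eps)); [|exact: mf|by move=> z; exact: f0].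
rewrite -[leRHS](@integral_cst _ _ _ (as_finite mu_fin) setT) //.
apply: ge0_le_integral => //.
- by move=> s _; apply: integral_ge0 => t _; exact: f0.
- apply: (measurable_fun_fubini_tonelli_G (m1 := leb) (f a b eps)).
    exact: mf.
  by move=> z; exact: f0.
move=> s _ /=; apply: le_trans (integral_poisson_le s e0 ab).
rewrite [leRHS]integral_mkcond; rewrite le_eqVlt; apply/orP; left; apply/eqP.
apply: eq_integral => t _; rewrite /f patchE /= indicE.
by case: ifPn => _; rewrite ?mul1r ?mul0r.
Qed.

Lemma poisson_integral_blowup (a b : R) : (a < b)%R ->
  ~ (forall t, (a <= t <= b)%R -> forall M, exists2 d : R, (0 < d)%R &
      forall eps, (0 < eps < d)%R -> M%:E <= \int[mu]_s (poisson eps t s)%:E).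
Proof.
move=> ab h.
pose e n : R := (n.+1%:R^-1)%R.
have e0 n : (0 < e n)%R by rewrite invr_gt0.
pose g n t := F a b (e n) t.
have mg n : measurable_fun [set: measurableTypeR R] (g n).
  apply: (measurable_fun_fubini_tonelli_F (m2 := as_finite mu_fin) (f a b (e n))).
    exact: mf.
  by move=> z; exact: f0.
have g0 n t : 0 <= g n t by apply: integral_ge0 => s _; exact: f0.
(* An infinite liminf along [e n] needs the lower bound at all small [eps], not only at some. *)
have ginf t : `[a, b]%classic t -> limn_einf (g ^~ t) = +oo.
  move=> tab; apply: (cvg_limn_einf_sup _).1; apply/cvgeyPge => M.
  have [d d0 hd] := h t tab M.
  have [N [Nd _]] := archi_inv_lt 0 d0.
  exists N => // n /= Nn; rewrite /g /F.
  have -> : \int[as_finite mu_fin]_s f a b (e n) (t, s)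
      = \int[mu]_s (poisson (e n) t s)%:E.
    by apply: eq_integral => s _; rewrite /f /= indicE mem_set // mul1r.
  apply: hd; rewrite e0 (le_lt_trans _ Nd) // /e lef_pV2 ?posrE // ler_nat.
  by rewrite ltnS.
have mab : measurable (`[a, b]%classic : set (measurableTypeR R)) by [].
have := fatou leb mab (fun n => measurable_funTS (mg n)) (fun n t _ => g0 n t).
apply/negP; rewrite -ltNge.
apply: (@le_lt_trans _ _ (pi%:E * mu setT)).
  rewrite limn_einf_lim; apply: lime_le; first exact: is_cvg_einfs.
  apply: nearW => n; apply: le_trans (integral_F_le ab (e0 n)).
  apply: (@le_trans _ _ (\int[leb]_(t in `[a, b]%classic) g n t)).
    by apply: ereal_inf_lbound; exists n => //=.
  exact: ge0_subset_integral.
apply: (@lt_le_trans _ _ +oo).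
  by rewrite -ge0_fin_numE ?mule_ge0 ?lee_fin ?pi_ge0 // fin_numM // ge0_fin_numE.
rewrite (_ : integral _ _ _ = \int[leb]_(t in `[a, b]%classic) cst +oo t); last first.
  by apply: eq_integral => t; rewrite inE; exact: ginf.
rewrite (integral_cst leb mab +oo) /leb /= lebesgue_measure_itv /= lte_fin ab.
by rewrite gt0_mulye // -EFinB lte_fin subr_gt0.
Qed.

End PoissonBlowup.

(** * Unconditional sums and the Hilbert space of square-summable functions *)

Section EsumReal.
Variables (R : realType) (V : choiceType).
Local Open Scope classical_set_scope.
Local Open Scope ereal_scope.
Implicit Types f g p q : V -> R.

Let S f := \esum_(x in [set: V]) (f x)%:E.

Lemma ge0_esumZl (c : R) f : (0 <= c)%R -> (forall x, 0 <= f x)%R ->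
  \esum_(x in [set: V]) (c * f x)%:E = c%:E * \esum_(x in [set: V]) (f x)%:E.
Proof.
have le_scale (k : R) h : (0 <= k)%R -> (forall x, 0 <= h x)%R ->
    S (fun x => k * h x)%R <= k%:E * S h.
  move=> k0 h0; apply: ge_ereal_sup => _ [A hA <-].
  under eq_fsbigr do rewrite EFinM.
  rewrite -ge0_mule_fsumr; last by move=> x; rewrite lee_fin.
  apply: lee_wpmul2l; first by rewrite lee_fin.
  by apply: ereal_sup_ubound; exists A.
rewrite le_eqVlt => /predU1P[<-|c0] f0.
  by rewrite mul0e esum1 // => x _; rewrite mul0r.
apply/eqP; rewrite eq_le le_scale ?(ltW c0) //=.
rewrite -lee_pdivlMl //; apply: le_trans (le_scale c^-1%R _ _ _).
- by apply: le_esum => x _; rewrite mulKf // gt_eqF.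
- by rewrite invr_ge0 ltW.
- by move=> x; rewrite mulr_ge0 // ltW.
Qed.

Definition rsummable f := \esum_(x in [set: V]) `|f x|%:E < +oo.

Lemma esum_dominated f g : (forall x, 0 <= f x <= g x)%R -> S g < +oo -> S f \is a fin_num.
Proof.
move=> fg gfin; rewrite ge0_fin_numE.
  by apply: le_lt_trans gfin; apply: le_esum => x _; rewrite lee_fin; case/andP: (fg x).
by apply: esum_ge0 => x _; rewrite lee_fin; case/andP: (fg x).
Qed.

(** [rsum] is defined by positive and negative parts, which do not add; any decomposition into
    summable nonnegative families computes it, and linearity follows. *)
Lemma rsum_sub p q : (forall x, 0 <= p x)%R -> (forall x, 0 <= q x)%R ->
  S p \is a fin_num -> S q \is a fin_num ->
  rsum (fun x => p x - q x)%R = (fine (S p) - fine (S q))%R.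
Proof.
move=> p0 q0 hp hq; rewrite /rsum.
set P := \esum_(x in _) (Num.max (p x - q x) 0)%:E.
set Q := \esum_(x in _) (Num.max (- (p x - q x)) 0)%:E.
have le_max0 (a b : R) : (0 <= a)%R -> (0 <= b)%R -> (0 <= Num.max (a - b) 0 <= a)%R.
  by move=> a0 b0; rewrite le_max lexx orbT /= ge_max a0 andbT gerBl.
have hP : P \is a fin_num.
  apply: (@esum_dominated _ p); last first.
    by rewrite -ge0_fin_numE ?esum_ge0 // => *; rewrite lee_fin.
  by move=> x; exact: le_max0.
have hQ : Q \is a fin_num.
  apply: (@esum_dominated _ q); last first.
    by rewrite -ge0_fin_numE ?esum_ge0 // => *; rewrite lee_fin.
  by move=> x; rewrite opprB; exact: le_max0.
have E : P + S q = S p + Q.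
  rewrite -!esumD; try by move=> x _; rewrite lee_fin ?le_max ?lexx ?orbT.
  apply: eq_esum => x _; rewrite -!EFinD; congr EFin.
  have [h|h] := leP (p x - q x)%R 0%R; have [h'|h'] := leP (- (p x - q x))%R 0%R; lra.
have : (fine P + fine (S q) = fine (S p) + fine Q)%R by rewrite -!fineD // E.
by rewrite fineB //; lra.
Qed.

Lemma rsummable_posneg f : rsummable f ->
  exists p q, [/\ forall x, (0 <= p x)%R, forall x, (0 <= q x)%R,
    S p \is a fin_num, S q \is a fin_num & f = (fun x => p x - q x)%R].
Proof.
move=> hf; exists (fun x => Num.max (f x) 0%R), (fun x => Num.max (- f x)%R 0%R).
split.
- by move=> x; rewrite le_max lexx orbT.
- by move=> x; rewrite le_max lexx orbT.
- apply: esum_dominated hf => x.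
  by rewrite le_max lexx orbT /= ge_max ler_norm normr_ge0.
- apply: esum_dominated hf => x.
  by rewrite le_max lexx orbT /= ge_max normr_ge0 andbT -normrN ler_norm.
- apply/funext => x.
  by have [h|h] := leP (f x) 0%R; have [h'|h'] := leP (- f x)%R 0%R; lra.
Qed.

Let finS_D p q : (forall x, 0 <= p x)%R -> (forall x, 0 <= q x)%R ->
  S (fun x => p x + q x)%R = S p + S q.
Proof.
move=> p0 q0; rewrite /S; under eq_esum do rewrite EFinD.
by rewrite esumD // => x _; rewrite lee_fin.
Qed.

Lemma rsumD f g : rsummable f -> rsummable g ->
  rsum (fun x => f x + g x)%R = (rsum f + rsum g)%R.
Proof.
move=> /rsummable_posneg[p [q [p0 q0 hp hq ->]]].
move=> /rsummable_posneg[p' [q' [p'0 q'0 hp' hq' ->]]].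
rewrite (_ : (fun x => _) = (fun x => (p x + p' x) - (q x + q' x))%R); last first.
  by apply/funext => x; ring.
rewrite !rsum_sub ?finS_D ?fin_numD ?hp ?hp' ?hq ?hq' //; try by move=> x; rewrite addr_ge0.
by rewrite !fineD //; ring.
Qed.

Lemma rsumN f : rsummable f -> rsum (fun x => - f x)%R = (- rsum f)%R.
Proof.
move=> /rsummable_posneg[p [q [p0 q0 hp hq ->]]].
rewrite (_ : (fun x => - _)%R = (fun x => q x - p x)%R); last first.
  by apply/funext => x; ring.
by rewrite !rsum_sub // opprB.
Qed.

Lemma rsumZ c f : rsummable f -> rsum (fun x => c * f x)%R = (c * rsum f)%R.
Proof.
move=> hf; wlog c0 : c / (0 <= c)%R.
  move=> h; have [/h //|/ltW c0] := leP 0%R c.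
  have {}h := h (- c)%R; rewrite -[RHS]opprK -mulNr -h ?oppr_ge0 //.
  rewrite -[in LHS](opprK c) (_ : (fun x => _) = (fun x => - (- c * f x))%R).
    rewrite rsumN // /rsummable; under eq_esum do rewrite normrM.
    rewrite ge0_esumZl //; apply: lte_mul_pinfty => //.
  by apply/funext => x; ring.
have [p [q [p0 q0 hp hq ->]]] := rsummable_posneg hf.
rewrite (_ : (fun x => _) = (fun x => c * p x - c * q x)%R); last first.
  by apply/funext => x; ring.
rewrite !rsum_sub // /S ?ge0_esumZl ?fin_numM //; try by move=> x; rewrite mulr_ge0.
by rewrite !fineM //=; ring.
Qed.

Lemma rsum_ge0E f : (forall x, 0 <= f x)%R -> rsum f = fine (S f).
Proof.
move=> f0; rewrite /rsum; congr fine.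
rewrite [X in _ - X]esum1 ?sube0.
  by apply: eq_esum => x _; rewrite max_l.
by move=> x _; rewrite max_r // oppr_le0.
Qed.

Lemma rsum_single f y : (forall x, x != y -> f x = 0%R) -> rsum f = f y.
Proof.
have single g : (forall x, 0 <= g x)%R -> (forall x, x != y -> g x = 0%R) ->
    \esum_(x in [set: V]) (g x)%:E = (g y)%:E.
  move=> g0 gy; rewrite -(@esum_set1 _ _ y (fun x => (g x)%:E)) ?lee_fin //.
  rewrite [RHS]esum_mkcond; apply: eq_esum => x _.
  case: ifPn => // h; rewrite gy //; apply: contraNneq h => ->; exact: mem_set.
move=> fy; rewrite /rsum.
rewrite (single (fun x => Num.max (f x)%R 0%R)); last 2 first.
- by move=> x; rewrite le_max lexx orbT.
- by move=> x /fy ->; rewrite maxxx.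
rewrite (single (fun x => Num.max (- f x)%R 0%R)); last 2 first.
- by move=> x; rewrite le_max lexx orbT.
- by move=> x /fy ->; rewrite oppr0 maxxx.
by rewrite -EFinB /=; have [h|h] := leP (f y) 0%R; have [h'|h'] := leP (- f y)%R 0%R; lra.
Qed.

End EsumReal.

Section L2.
Variables (R : realType) (V : choiceType).
Local Open Scope classical_set_scope.
Local Open Scope complex_scope.
Implicit Types (u v w : V -> R[i]) (a k : R[i]).

Definition nrm2 u : R := fine (\esum_(x in [set: V]) (sqn (u x))%:E).

Lemma l2E u : l2 u = (\esum_(x in [set: V]) (sqn (u x))%:E < +oo)%E.
Proof. by []. Qed.

Lemma l2_fin u : l2 u -> (\esum_(x in [set: V]) (sqn (u x))%:E)%E \is a fin_num.
Proof.
move=> hu; rewrite ge0_fin_numE //.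
by apply: esum_ge0 => x _; rewrite lee_fin sqn_ge0.
Qed.

Lemma nrm2_ge0 u : 0 <= nrm2 u.
Proof. by apply: fine_ge0; apply: esum_ge0 => x _; rewrite lee_fin sqn_ge0. Qed.

Lemma sqn_lin a (z w : R[i]) : sqn (a * z + w) <= 2 * sqn a * sqn z + 2 * sqn w.
Proof.
rewrite -[leRHS]addr0 -subr_ge0 (_ : _ - _ = sqn (a * z - w)) ?sqn_ge0 //.
by rewrite /sqn !ReImE; ring.
Qed.

Lemma l2_lin a u v : l2 u -> l2 v -> l2 (fun x => a * u x + v x).
Proof.
move=> hu hv; rewrite l2E.
apply: (@le_lt_trans _ _ (\esum_(x in [set: V])
    ((2 * sqn a * sqn (u x))%:E + (2 * sqn (v x))%:E)%E)%E).
  by apply: le_esum => x _; rewrite -EFinD lee_fin sqn_lin.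
have s0 := @sqn_ge0 R.
rewrite esumD; try by move=> x _; rewrite lee_fin !mulr_ge0.
rewrite !ge0_esumZl ?mulr_ge0 //.
by rewrite lte_add_pinfty //; apply: lte_mul_pinfty; rewrite ?lee_fin ?mulr_ge0.
Qed.

Lemma l2_0 : l2 (fun _ : V => 0 : R[i]).
Proof. by rewrite l2E esum1 // => x _; rewrite /sqn /= expr0n addr0. Qed.

Lemma l2Z a u : l2 u -> l2 (fun x => a * u x).
Proof.
move=> hu; have := l2_lin a hu l2_0.
rewrite (_ : (fun x => a * u x + 0) = (fun x => a * u x)) //.
by apply/funext => x; rewrite addr0.
Qed.

Lemma l2D u v : l2 u -> l2 v -> l2 (fun x => u x + v x).
Proof.
move=> hu hv; have := l2_lin 1 hu hv.
rewrite (_ : (fun x => 1 * u x + _) = (fun x => u x + v x)) //.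
by apply/funext => x; rewrite mul1r.
Qed.

Lemma rsummable_dot u v : l2 u -> l2 v ->
  rsummable (fun x => complex.Re ((u x)^* * v x)) /\
  rsummable (fun x => complex.Im ((u x)^* * v x)).
Proof.
move=> hu hv; have : (\esum_(x in [set: V]) ((sqn (u x))%:E + (sqn (v x))%:E)%E < +oo)%E.
  by rewrite esumD ?lte_add_pinfty // => x _; rewrite lee_fin sqn_ge0.
move=> h; split; apply: le_lt_trans h; apply: le_esum => x _;
  rewrite -EFinD lee_fin /sqn; case: (u x) (v x) => p q [r s] /=;
  rewrite ler_norml; apply/andP;
  have := sqr_ge0 (p - r); have := sqr_ge0 (p + r); have := sqr_ge0 (q - s);
  have := sqr_ge0 (q + s); have := sqr_ge0 (p - s); have := sqr_ge0 (p + s);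
  have := sqr_ge0 (q - r); have := sqr_ge0 (q + r);
  have := sqr_ge0 p; have := sqr_ge0 q; have := sqr_ge0 r; have := sqr_ge0 s;
  split; nra.
Qed.

Lemma dotDr w u v : l2 w -> l2 u -> l2 v ->
  dot w (fun x => u x + v x) = dot w u + dot w v.
Proof.
move=> hw hu hv; have [r1 i1] := rsummable_dot hw hu; have [r2 i2] := rsummable_dot hw hv.
apply: complex_eq; rewrite ?cReD ?cImD /= -rsumD //; congr rsum; apply/funext => x;
  by rewrite mulrDr ?cReD ?cImD.
Qed.

Lemma rsummableZ (c : R) (f : V -> R) : rsummable f -> rsummable (fun x => c * f x).
Proof.
move=> hf; rewrite /rsummable; under eq_esum do rewrite normrM.
by rewrite ge0_esumZl //; apply: lte_mul_pinfty; rewrite ?lee_fin.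
Qed.

Lemma dotZr w a u : l2 w -> l2 u -> dot w (fun x => a * u x) = a * dot w u.
Proof.
move=> hw hu; have [r1 i1] := rsummable_dot hw hu.
case: a => a b; apply: complex_eq; rewrite ?cReM ?cImM /=.
  rewrite -mulNr -!rsumZ // -rsumD; try exact: rsummableZ.
  by congr rsum; apply/funext => x; rewrite !ReImE /=; ring.
rewrite -!rsumZ // -rsumD; try exact: rsummableZ.
by congr rsum; apply/funext => x; rewrite !ReImE /=; ring.
Qed.

Lemma dotC u v : l2 u -> l2 v -> dot u v = (dot v u)^*.
Proof.
move=> hu hv; have [r1 i1] := rsummable_dot hv hu.
apply: complex_eq; rewrite ?cReJ ?cImJ /=.
  by congr rsum; apply/funext => x; rewrite !ReImE; ring.
by rewrite -rsumN //; congr rsum; apply/funext => x; rewrite !ReImE; ring.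
Qed.

Lemma dotDl w u v : l2 w -> l2 u -> l2 v ->
  dot (fun x => u x + v x) w = dot u w + dot v w.
Proof.
move=> hw hu hv; have huv := l2D hu hv.
by rewrite dotC // dotDr // rmorphD (dotC hu hw) (dotC hv hw).
Qed.

Lemma dotZl w a u : l2 w -> l2 u -> dot (fun x => a * u x) w = a^* * dot u w.
Proof.
move=> hw hu; have hau := l2Z a hu.
by rewrite dotC // dotZr // rmorphM (dotC hu hw).
Qed.

Lemma dot0r u : l2 u -> dot u (fun=> 0) = 0.
Proof.
move=> hu; have -> : (fun=> 0) = (fun x => 0 * u x) by apply/funext => x; rewrite mul0r.
by rewrite dotZr // mul0r.
Qed.

Lemma dot0l u : l2 u -> dot (fun=> 0) u = 0.
Proof. by move=> hu; rewrite (dotC l2_0 hu) dot0r // raddf0. Qed.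

Lemma dot_nrm2 u : dot u u = (nrm2 u)%:C.
Proof.
apply: complex_eq => /=.
  rewrite rsum_ge0E.
    by congr fine; apply: eq_esum => x _; congr EFin; rewrite !ReImE /sqn; ring.
  by move=> x; rewrite !ReImE mulNr opprK -!expr2 addr_ge0 // sqr_ge0.
rewrite (_ : (fun x => _) = fun=> 0); first by rewrite rsum_ge0E // esum1.
by apply/funext => x; rewrite !ReImE; ring.
Qed.

Lemma nrm2_eq0 u : l2 u -> nrm2 u = 0 -> u = fun=> 0.
Proof.
move=> hu h; apply/funext => x; apply/eqP; rewrite -sqn_eq0 eq_le sqn_ge0 andbT.
rewrite -h -lee_fin /nrm2 fineK ?l2_fin //.
apply: esum_ge; exists [set x]; first by split.
by rewrite fsbig_set1.
Qed.

Lemma nrm2D u v : l2 u -> l2 v -> nrm2 (fun x => u x + v x) =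
  nrm2 u + nrm2 v + 2 * complex.Re (dot u v).
Proof.
move=> hu hv; have huv := l2D hu hv.
apply: (@complexI R); rewrite -dot_nrm2 dotDl // !dotDr // !dot_nrm2 (dotC hv hu).
by case: (dot u v) => p q; apply: complex_eq; rewrite /= ?addr0; ring.
Qed.

Lemma nrm2Z a u : l2 u -> nrm2 (fun x => a * u x) = sqn a * nrm2 u.
Proof.
move=> hu; have hau := l2Z a hu.
apply: (@complexI R); rewrite -dot_nrm2 dotZl // dotZr // dot_nrm2.
by case: a {hau} => p q; apply: complex_eq; rewrite /sqn /=; ring.
Qed.

Definition delta (y x : V) : R[i] := (x == y)%:R.

Lemma l2_delta y : l2 (delta y).
Proof.
rewrite l2E (_ : esum _ _ = (1%:E : \bar R)) ?ltry //.
rewrite -(@esum_set1 R V y (fun=> 1%:E)) ?lee_fin // [RHS]esum_mkcond.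
apply: eq_esum => x _; rewrite /delta /sqn.
have [->|xy] := eqVneq x y; first by rewrite mem_set //= expr0n expr1n addr0.
rewrite memNset /=; first by rewrite expr0n addr0.
by move=> /= h; rewrite h eqxx in xy.
Qed.

Lemma dot_delta y u : dot (delta y) u = u y.
Proof.
have E x : (delta y x)^* * u x = if x == y then u y else 0.
  rewrite /delta; case: eqP => [->|_]; apply: complex_eq; rewrite !ReImE /=; ring.
apply: complex_eq => /=; rewrite (@rsum_single _ _ _ y) ?E ?eqxx // => x /negPf xy;
  by rewrite E xy.
Qed.

End L2.

(** * Operator bounds extracted from the quadratic form *)

Section Spectral.
Variables (R : realType) (V : choiceType).
Local Open Scope classical_set_scope.
Local Open Scope complex_scope.
Variable H : (V -> R[i]) -> V -> R[i].
Hypothesis Hl2 : forall u, l2 u -> l2 (H u).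
Hypothesis Hlin : forall (a : R[i]) u v, l2 u -> l2 v ->
  H (fun x => a * u x + v x) = fun x => a * H u x + H v x.
Variable E : set (measurableTypeR R) -> (V -> R[i]) -> V -> R[i].
Hypothesis hE : spectral_resolution H E.
Implicit Types (u v w : V -> R[i]) (a k : R[i]) (B I S : set (measurableTypeR R)).
Implicit Types (mu : {measure set (measurableTypeR R) -> \bar R}).

Let lin a u v := fun x => a * u x + v x.

Let roi := hE.1.
Let El2 B u : measurable B -> l2 u -> l2 (E B u).
Proof. by move=> mB; apply: proj_l2 (roi_proj roi mB) u. Qed.
Let Elin B a u v : measurable B -> l2 u -> l2 v -> E B (lin a u v) = lin a (E B u) (E B v).
Proof. by move=> mB hu hv; exact: (proj_linear (roi_proj roi mB)). Qed.
Let Eidem B u : measurable B -> l2 u -> E B (E B u) = E B u.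
Proof. by move=> mB hu; exact: (proj_idem (roi_proj roi mB)). Qed.
Let Esym B u v : measurable B -> l2 u -> l2 v -> dot (E B u) v = dot u (E B v).
Proof. by move=> mB hu hv; exact: (proj_sym (roi_proj roi mB)). Qed.

Let l2lin a u v : l2 u -> l2 v -> l2 (lin a u v). Proof. exact: l2_lin. Qed.

Let dot_linr w a u v : l2 w -> l2 u -> l2 v ->
  dot w (lin a u v) = a * dot w u + dot w v.
Proof. by move=> hw hu hv; rewrite dotDr ?dotZr //; exact: l2Z. Qed.

Let dot_linl w a u v : l2 w -> l2 u -> l2 v ->
  dot (lin a u v) w = a^* * dot u w + dot v w.
Proof. by move=> hw hu hv; rewrite dotDl ?dotZl //; exact: l2Z. Qed.

Let nrm2_lin a u v : l2 u -> l2 v ->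
  nrm2 (lin a u v) = sqn a * nrm2 u + nrm2 v + 2 * complex.Re (a^* * dot u v).
Proof. by move=> hu hv; rewrite nrm2D ?nrm2Z ?dotZl //; exact: l2Z. Qed.

Lemma scalar_measureE u mu B : l2 u -> scalar_measure E u mu -> measurable B ->
  mu B = (nrm2 (E B u))%:E.
Proof.
move=> hu hmu mB; have [h fin] := hmu B mB.
rewrite -(fineK fin); congr EFin; apply: (@complexI R).
by rewrite -h -dot_nrm2 Esym // ?Eidem //; exact: El2.
Qed.

Let q u := complex.Re (dot u (H u)).

Let dotHE u : l2 u -> dot u (H u) = (q u)%:C.
Proof.
move=> hu; have [mu hmu] := roi_measure roi hu.
by have [_ h] := hE.2 u mu hu hmu; rewrite /q h.
Qed.

(** The form is the first moment of the spectral measure, whose values are the [nrm2 (E B _)]; sums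
    of measures have additive first moments. *)
Let q_add u v w : l2 u -> l2 v -> l2 w ->
  (forall B, measurable B -> nrm2 (E B w) = nrm2 (E B u) + nrm2 (E B v)) ->
  q w = q u + q v.
Proof.
move=> hu hv hw h.
have [mu hmu] := roi_measure roi hu; have [iu Iu] := hE.2 u mu hu hmu.
have [nu hnu] := roi_measure roi hv; have [iv Iv] := hE.2 v nu hv hnu.
have [la hla] := roi_measure roi hw; have [iw Iw] := hE.2 w la hw hla.
rewrite /q Iu Iv Iw /= /Rintegral -fineD; try exact: integrable_fin_num.
rewrite -integral_measure_add //.
congr fine; apply: eq_measure_integral => A mA _.
rewrite [RHS](measure_addE mu nu) (scalar_measureE hw hla mA) (scalar_measureE hu hmu mA).
by rewrite (scalar_measureE hv hnu mA) h.
Qed.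

(** The spectral measure of a vector in the range of [E I] lives on [I] and has mass [nrm2 v]. *)
Let q_bound (I : set R) (c eta : R) v : measurable (I : set (measurableTypeR R)) ->
  (forall t, I t -> c - eta <= t <= c + eta) -> l2 v -> E I v = v ->
  `|q v - c * nrm2 v| <= eta * nrm2 v.
Proof.
move=> mI Ib hv EI; have [mu hmu] := roi_measure roi hv.
have [iv Iv] := hE.2 v mu hv hmu.
have mCI : measurable (~` I : set (measurableTypeR R)) by exact: measurableC.
have mu0 : mu (~` I) = 0%E.
  rewrite (scalar_measureE hv hmu) // -[in E _ v]EI.
  rewrite -(roi_setI roi) // setICl (roi_set0 roi) //.
  by rewrite /nrm2 esum1 // => x _; rewrite /sqn /= expr0n addr0.
have muI : mu I = (nrm2 v)%:E by rewrite (scalar_measureE hv hmu) // EI.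
rewrite /q Iv /=.
have -> : (\int[mu]_t t)%R = (\int[mu]_(t in I) t)%R.
  rewrite /Rintegral (negligible_integral mCI measurableT iv mu0).
  by rewrite setTD setCK.
have iI : mu.-integrable I (EFin \o idfun).
  by apply: integrableS iv.
have icst (k : R) : mu.-integrable I (EFin \o cst k).
  apply/integrableP; split; first by apply: measurableT_comp => //; exact: measurable_cst.
  rewrite (_ : (fun x => _) = cst (`|k|%:E)%E) //.
  by rewrite integral_cst //= muI -EFinM ltry.
have lo : (\int[mu]_(t in I) (c - eta) <= \int[mu]_(t in I) t)%R.
  by apply: le_Rintegral => // [|t /Ib/andP[]//]; exact: icst.
have hi : (\int[mu]_(t in I) t <= \int[mu]_(t in I) (c + eta))%R.
  by apply: le_Rintegral => // [|t /Ib/andP[]//]; exact: icst.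
move: lo hi; rewrite !Rintegral_cst // muI /= => lo hi.
by rewrite ler_norml; apply/andP; split; lra.
Qed.

Let dot_H_lin a u v : l2 u -> l2 v ->
  dot (lin a u v) (H (lin a u v)) = a^* * a * dot u (H u) + a^* * dot u (H v)
    + a * dot v (H u) + dot v (H v).
Proof.
move=> hu hv; rewrite (Hlin a hu hv).
have hHu := Hl2 hu; have hHv := Hl2 hv; have hl := l2lin a hHu hHv.
by rewrite dot_linl // !dot_linr //; ring.
Qed.

(** The form is real, being an integral of [t]; polarization with [u + v] and [i u + v] makes it
    Hermitian. *)
Lemma dot_symmetric u v : l2 u -> l2 v -> dot u (H v) = dot (H u) v.
Proof.
move=> hu hv; have hHu := Hl2 hu; rewrite (dotC hHu hv).
have h1 := dot_H_lin 1 hu hv; have h2 := dot_H_lin 'i hu hv.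
rewrite dotHE in h1; last exact: l2lin.
rewrite dotHE in h2; last exact: l2lin.
rewrite !dotHE // in h1 h2.
move: (dot u (H v)) (dot v (H u)) h1 h2 => x y h1 h2.
have := congr1 (@complex.Im R) h1; have := congr1 (@complex.Im R) h2.
rewrite !ReImE /= => e2 e1.
by apply: complex_eq; rewrite ?cReJ ?cImJ; lra.
Qed.

(* For [a = 1] and [a = i] the spectral measure of [a u + v] is the sum of those of
   [u] and [v], so the cross terms of its quadratic form vanish. *)
Let dot_H_orth B u v : measurable B -> l2 u -> l2 v -> E B u = u -> E B v = (fun=> 0) ->
  dot u (H v) = 0.
Proof.
move=> mB hu hv EBu EBv.
have orth S : measurable S -> dot (E S u) (E S v) = 0.
  move=> mS; rewrite Esym //; last exact: El2.
  rewrite Eidem // -[in LHS]EBu Esym //; last exact: El2.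
  rewrite -(roi_setI roi) // setIC (roi_setI roi) // EBv.
  have -> : E S (fun=> 0) = fun=> 0.
    have e0 : (fun _ : V => 0 : R[i]) = lin 0 u (fun=> 0).
      by apply/funext => x; rewrite /lin mul0r addr0.
    have := @Elin S (-1) (fun=> 0) (fun=> 0) mS (l2_0 _ _) (l2_0 _ _).
    have -> : lin (-1) (fun _ : V => 0 : R[i]) (fun=> 0) = fun=> 0.
      by apply/funext => x; rewrite /lin mulr0 addr0.
    by move=> ->; apply/funext => x; rewrite /lin mulN1r addNr.
  exact: dot0r.
have key a : sqn a = 1 -> a^* * a = 1 -> a^* * dot u (H v) + a * dot v (H u) = 0.
  move=> a1 aa; have hw := l2lin a hu hv.
  have : q (lin a u v) = q u + q v.
    apply: q_add => // S mS; rewrite Elin // nrm2_lin; try exact: El2.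
    by rewrite orth // mulr0 a1 mul1r mulr0 addr0.
  move=> /(congr1 (real_complex R)); rewrite rmorphD /= -!dotHE // dot_H_lin // aa mul1r.
  move/eqP; rewrite -subr_eq0 => /eqP <-; ring.
have k1 := key 1; have k2 := key 'i.
move: k1 k2; rewrite /sqn /= expr0n expr1n addr0 add0r => /(_ erefl) k1 /(_ erefl) k2.
have {k1} : 1^* * dot u (H v) + 1 * dot v (H u) = 0.
  by apply: k1; apply: complex_eq => /=; ring.
have {k2} : 'i^* * dot u (H v) + 'i * dot v (H u) = 0.
  by apply: k2; apply: complex_eq => /=; ring.
move: (dot u (H v)) (dot v (H u)) => x y k2 k1.
have := congr1 (@complex.Re R) k1; have := congr1 (@complex.Re R) k2.
have := congr1 (@complex.Im R) k1; have := congr1 (@complex.Im R) k2.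
rewrite !ReImE /= => e1 e2 e3 e4.
by apply: complex_eq => /=; lra.
Qed.

(** By [dot_H_orth], [H] has no matrix elements between the range and the kernel of [E B], so it
    preserves both; [u] splits as [a + b] accordingly. *)
Lemma spectral_commute B u : measurable B -> l2 u -> E B (H u) = H (E B u).
Proof.
move=> mB hu; set a := E B u; have ha : l2 a by exact: El2.
set b := lin (-1) a u; have hb : l2 b by exact: l2lin.
have EB_sub w : l2 w -> E B (lin (-1) (E B w) w) = fun=> 0.
  move=> hw; rewrite Elin ?Eidem //; last exact: El2.
  by apply/funext => x; rewrite /lin mulN1r addNr.
have claimA : E B (H a) = H a.
  have hHa := Hl2 ha; have hEHa := El2 mB hHa.
  set c := lin (-1) (E B (H a)) (H a); have hc : l2 c by exact: l2lin.
  have Hac : dot (H a) c = 0.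
    rewrite -dot_symmetric //; apply: (dot_H_orth mB) => //; last exact: EB_sub.
    exact: Eidem.
  have : nrm2 c = 0.
    apply: (@complexI R); rewrite -dot_nrm2 {1}/c dot_linl // Hac Esym //.
    by rewrite EB_sub // dot0r // mulr0 addr0.
  move/(nrm2_eq0 hc) => c0; apply/funext => x.
  have := congr1 (fun f => f x) c0; rewrite /c /lin mulN1r.
  by move/eqP; rewrite addrC subr_eq0 => /eqP.
have claimB : E B (H b) = fun=> 0.
  have hHb := Hl2 hb; set d := E B (H b); have hd : l2 d by exact: El2.
  apply: nrm2_eq0 => //; apply: (@complexI R); rewrite -dot_nrm2 {1}/d Esym //.
  have Ed : E B d = d by exact: Eidem.
  rewrite Ed dotC // (dot_H_orth mB hd hb Ed) ?conjc0 //; exact: EB_sub.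
have ub : u = lin 1 a b by apply/funext => x; rewrite /b /lin; ring.
rewrite {1}ub (Hlin 1 ha hb) Elin; [|exact: mB|exact: Hl2|exact: Hl2].
by rewrite claimA claimB; apply/funext => x; rewrite /lin addr0 mul1r.
Qed.

Let K (c : R) v := lin (- c%:C) v (H v).
Let Kl2 c v : l2 v -> l2 (K c v).
Proof. by move=> hv; apply: l2lin => //; exact: Hl2. Qed.

Let dotK c v : l2 v -> dot v (K c v) = (q v - c * nrm2 v)%:C.
Proof.
move=> hv; rewrite dot_linr ?dotHE ?dot_nrm2 //; last exact: Hl2.
by apply: complex_eq => /=; ring.
Qed.

(* Polarization of the bound [q_bound] at [v] and [w = K c v], scaled by
   [eta^-1]. *)
Lemma nrm2_shift_le (I : set R) (c eta : R) v :
  measurable (I : set (measurableTypeR R)) -> 0 < eta ->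
  (forall t, I t -> c - eta <= t <= c + eta) -> l2 v -> E I v = v ->
  nrm2 (K c v) <= eta ^+ 2 * nrm2 v.
Proof.
move=> mI eta0 Ib hv EI; set w := K c v; have hw : l2 w by exact: Kl2.
have hHv := Hl2 hv; have hHw := Hl2 hw.
have EIw : E I w = w by rewrite /w /K Elin // spectral_commute // EI.
have bnd (s : R) : `|q (lin s%:C w v) - c * nrm2 (lin s%:C w v)|
    <= eta * nrm2 (lin s%:C w v).
  by apply: q_bound Ib _ _ => //; [exact: l2lin | rewrite Elin // EI EIw].
have Eq (s : R) : q (lin s%:C w v) =
    s ^+ 2 * q w + q v + 2 * s * complex.Re (dot w (H v)).
  rewrite {1}/q dot_H_lin // (dot_symmetric hv hw) (dotC hHv hw) !dotHE //.
  by move: (dot w (H v)) (q w) (q v) => x y z; rewrite !ReImE /=; ring.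
have En (s : R) : nrm2 (lin s%:C w v) =
    s ^+ 2 * nrm2 w + nrm2 v + 2 * s * complex.Re (dot w v).
  by rewrite nrm2_lin // sqn_real; move: (dot w v) => x; rewrite !ReImE /=; ring.
have EN : nrm2 w = complex.Re (dot w (H v)) - c * complex.Re (dot w v).
  have : dot w w = dot w (lin (- c%:C) v (H v)) by [].
  rewrite [LHS]dot_nrm2 dot_linr //; move: (dot w v) (dot w (H v)) => x y.
  by move=> /(congr1 (@complex.Re R)); rewrite !ReImE /= => ->; ring.
have h1 := ler_normlW (bnd eta^-1).
have h2 : - (q (lin (- eta^-1)%:C w v) - c * nrm2 (lin (- eta^-1)%:C w v)) <=
  eta * nrm2 (lin (- eta^-1)%:C w v).
  by apply: le_trans (bnd _); rewrite -normrN ler_norm.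
move: h1 h2; rewrite !Eq !En; set X := complex.Re _ in EN *; set Y := complex.Re _ in EN *.
have EX : X = nrm2 w + c * Y by rewrite EN subrK.
rewrite EX.
have e1 : eta * eta^-1 = 1 by rewrite divff // gt_eqF.
set e := eta^-1 in e1 *; have e_gt0 : 0 < e by rewrite invr_gt0.
(* The upper bound at [s = e] plus the lower bound at [s = - e] cancels [q w] and [q v]; since
   [eta e = 1], half of the left side absorbs the [nrm2 w] term on the right. *)
move=> h1 h2; have : 4 * e * nrm2 w <= 2 * (eta * (e ^+ 2 * nrm2 w + nrm2 v)).
  by move: h1 h2; set Z := nrm2 w; set n := nrm2 v; lra.
have -> : 2 * (eta * (e ^+ 2 * nrm2 w + nrm2 v)) =
    2 * (eta * e) * e * nrm2 w + 2 * eta * nrm2 v by ring.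
rewrite e1 => h3; have : e * nrm2 w <= eta * nrm2 v by lra.
by rewrite mulrC ler_pdivrMr // mulrAC expr2.
Qed.


(** The cross term between [(H - t) v] and [i eps v] has real part 0, as the form of [H - t] is
    real. *)
Let nrm2_res (t eps : R) v : l2 v ->
  nrm2 (lin (- (t +i* eps)) v (H v)) = nrm2 (K t v) + eps ^+ 2 * nrm2 v.
Proof.
move=> hv; have -> : lin (- (t +i* eps)) v (H v) = lin (- (0 +i* eps)) v (K t v).
  by apply/funext => x; apply: complex_eq; rewrite /lin !ReImE /=; ring.
rewrite nrm2_lin ?dotK //; last exact: Kl2.
by rewrite /sqn /=; ring.
Qed.

Let nrm2_E_le B u : measurable B -> l2 u -> nrm2 (E B u) <= nrm2 u.
Proof.
move=> mB hu; have [mu hmu] := roi_measure roi hu.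
rewrite -lee_fin -(scalar_measureE hu hmu mB) -[in leRHS](roi_setT roi hu).
by rewrite -(scalar_measureE hu hmu measurableT); apply: le_measure; rewrite ?inE.
Qed.

Let nrm2_parallelogram u v : l2 u -> l2 v ->
  nrm2 (lin (-1) u v) <= 2 * nrm2 u + 2 * nrm2 v.
Proof.
move=> hu hv; have := nrm2_ge0 (lin 1 u v); rewrite !nrm2_lin // /sqn.
by move: (dot u v) => x; rewrite !ReImE /=; lra.
Qed.

Variables (y : V) (u : V -> R[i]) (t eps : R).
Hypotheses (eps0 : 0 < eps) (hu : l2 u).
Hypothesis Hu : forall x, H u x - (t +i* eps) * u x = delta R y x.

Let E_delta B : measurable B ->
  E B (delta R y) = lin (- (t +i* eps)) (E B u) (H (E B u)).
Proof.
move=> mB; rewrite -spectral_commute // -Elin //; last exact: Hl2.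
by congr E; apply/funext => x; rewrite -Hu /lin mulNr addrC.
Qed.

(** Pair [(H - z) u = delta] with [u]: the form of [H] is real, so only [i eps] contributes to the
    imaginary part. *)
Lemma resolvent_Im : complex.Im (u y) = eps * nrm2 u.
Proof.
have hHu := Hl2 hu.
have E1 : dot u (delta R y) = - (t +i* eps) * dot u u + dot u (H u).
  rewrite -dot_linr //; congr dot; apply/funext => x.
  by rewrite -Hu /lin mulNr addrC.
move: E1; rewrite (dotC hu (l2_delta _ _)) dot_delta dotHE // dot_nrm2.
move=> /(congr1 (@complex.Im R)); rewrite !ReImE /=; lra.
Qed.

Variable mu : {measure set (measurableTypeR R) -> \bar R}.
Hypothesis hmu : scalar_measure E (delta R y) mu.

Let mu_E B : measurable B -> mu B = (nrm2 (E B (delta R y)))%:E.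
Proof. exact: (scalar_measureE (l2_delta R y) hmu). Qed.

(** The mass is the squared norm of [(H - z) E I u]. The parts [H - t] and [i eps] each contribute
    at most [eps ^+ 2 * nrm2 u], whence the factor 2. *)
Lemma spectral_measure_itv_le :
  (mu `](t - eps)%R, (t + eps)%R[%classic <= (eps * (2 * complex.Im (u y)))%:E)%E.
Proof.
set I : set (measurableTypeR R) := `]t - eps, t + eps[%classic.
have mI : measurable I by exact: measurable_itv.
have hv : l2 (E I u) by exact: El2.
rewrite mu_E // lee_fin E_delta // nrm2_res // resolvent_Im.
have h1 : nrm2 (K t (E I u)) <= eps ^+ 2 * nrm2 (E I u).
  apply: (nrm2_shift_le mI) => //; last exact: Eidem.
  by move=> s; rewrite /I /= in_itv /= => /andP[/ltW -> /ltW ->].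
have h2 : eps ^+ 2 * nrm2 (E I u) <= eps ^+ 2 * nrm2 u.
  by rewrite ler_wpM2l ?sqr_ge0 // nrm2_E_le.
have -> : eps * (2 * (eps * nrm2 u)) = 2 * (eps ^+ 2 * nrm2 u) by ring.
lra.
Qed.

(** Heuristically [nu] has density [|s - z|^-2] with respect to [mu]. On an interval of length [eps]
    this holds up to constants, with [D = |c - z|^2] for [|s - z|^2]: [h3] loses a factor 4 and the
    kernel denominator is at most [5 / 2 * D], together 10. *)
Let piece (c : R) (nu : {measure set (measurableTypeR R) -> \bar R}) :
  scalar_measure E u nu ->
  (nu `[(c - eps / 2)%R, (c + eps / 2)%R[%classic <=
   (10 / eps)%:E * \int[mu]_(s in `[(c - eps / 2)%R, (c + eps / 2)%R[%classic)
     (poisson eps t s)%:E)%E.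
Proof.
move=> hnu; set I : set (measurableTypeR R) := `[c - eps / 2, c + eps / 2[%classic.
have mI : measurable I by exact: measurable_itv.
have hv : l2 (E I u) by exact: El2.
have Ib s : I s -> c - eps / 2 <= s <= c + eps / 2.
  by rewrite /I /= in_itv /= => /andP[-> /ltW ->].
have h1 : nrm2 (K c (E I u)) <= (eps / 2) ^+ 2 * nrm2 (E I u).
  by apply: (nrm2_shift_le mI) => //; [rewrite divr_gt0 | exact: Eidem].
set D := (c - t) ^+ 2 + eps ^+ 2.
have De : eps ^+ 2 <= D by rewrite lerDr sqr_ge0.
have D0 : 0 < D by apply: lt_le_trans De; rewrite exprn_gt0.
set n := nrm2 (E I u) in h1 *; have n0 : 0 <= n by exact: nrm2_ge0.
set m := nrm2 (E I (delta R y)).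
have h2 : D * n <= 2 * m + 2 * nrm2 (K c (E I u)).
  (* Subtracting [(H - c) E I u] from [E I delta = (H - z) E I u] leaves [(c - z) E I u]. *)
  have -> : D * n = nrm2 (lin (-1) (K c (E I u)) (E I (delta R y))).
    rewrite E_delta // (_ : lin _ _ _ = fun x => (c%:C - (t +i* eps)) * E I u x).
      by rewrite nrm2Z // /sqn /D /= sub0r sqrrN.
    by apply/funext => x; rewrite /K /lin; ring.
  rewrite [leRHS]addrC; apply: nrm2_parallelogram; first exact: Kl2.
  by apply: El2 => //; exact: l2_delta.
have h3 : D * n <= 4 * m.
  have : (eps / 2) ^+ 2 * n <= 4^-1 * (D * n).
    have -> : (eps / 2) ^+ 2 * n = 4^-1 * (eps ^+ 2 * n) by field.
    by rewrite ler_pM2l // ler_wpM2r.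
  lra.
have h4 : ((eps / (5 / 2 * D))%:E * mu I <= \int[mu]_(s in I) (poisson eps t s)%:E)%E.
  rewrite -(integral_cst mu mI (eps / (5 / 2 * D))%:E).
  apply: ge0_le_integral => //.
  - by move=> s _; rewrite lee_fin divr_ge0 ?(ltW eps0) // mulr_ge0 // ltW.
  - by apply/measurable_EFinP; apply: measurable_funTS; exact: measurable_poisson_fst.
  - move=> s /Ib /andP[s1 s2]; rewrite lee_fin /poisson ler_pM2l //.
    rewrite lef_pV2 ?posrE ?mulr_gt0 ?poisson_den_gt0 //.
    have e2 : (s - c) ^+ 2 <= (eps / 2) ^+ 2.
      rewrite -subr_ge0 (_ : _ - _ = (eps / 2 - (s - c)) * (eps / 2 + (s - c))).
        by rewrite mulr_ge0 //; lra.
      by ring.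
    have e3 : (s - t) ^+ 2 <= 2 * (s - c) ^+ 2 + 2 * (c - t) ^+ 2.
      rewrite -subr_ge0 (_ : _ - _ = ((s - c) - (c - t)) ^+ 2) ?sqr_ge0 //.
      by ring.
    have e4 : (eps / 2) ^+ 2 = 4^-1 * eps ^+ 2 by field.
    by rewrite /D; have := sqr_ge0 (c - t); have := sqr_ge0 eps; rewrite e4 in e2; lra.
rewrite (scalar_measureE hu hnu mI) -/n.
have k0 : (0%R <= (10 / eps)%:E)%E by rewrite lee_fin divr_ge0 // ltW.
apply: le_trans (lee_wpmul2l k0 h4); rewrite mu_E // -/m -!EFinM lee_fin.
have -> : 10 / eps * (eps / (5 / 2 * D) * m) = 4 * m / D.
  by field; rewrite !gt_eqF.
by rewrite ler_pdivlMr // mulrC.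
Qed.

Let pieces (al : R) (n : nat) (nu : {measure set (measurableTypeR R) -> \bar R}) :
  scalar_measure E u nu ->
  (nu `[al, (al + eps *+ n)%R[%classic <=
   (10 / eps)%:E * \int[mu]_(s in `[al, (al + eps *+ n)%R[%classic) (poisson eps t s)%:E)%E.
Proof.
move=> hnu; have k0 : (0%R <= (10 / eps)%:E)%E by rewrite lee_fin divr_ge0 // ltW.
elim: n => [|n IH]; first by rewrite mulr0n addr0 set_itvco0 measure0 integral_set0 mule0.
set J : set (measurableTypeR R) := `[al, al + eps *+ n[%classic in IH *.
set c := al + eps *+ n + eps / 2.
set I : set (measurableTypeR R) := `[c - eps / 2, c + eps / 2[%classic.
have mI : measurable I by exact: measurable_itv.
have mJ : measurable J by exact: measurable_itv.
have c1 : c - eps / 2 = al + eps *+ n by rewrite /c; ring.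
have c2 : c + eps / 2 = al + eps *+ n.+1 by rewrite /c mulrS; field.
have JI0 : J `&` I = set0.
  apply/seteqP; split => // s [] /=; rewrite /J /I /= !in_itv /= c1.
  by move=> /andP[_ h] /andP[h' _]; move: (lt_le_trans h h'); rewrite ltxx.
have -> : `[al, al + eps *+ n.+1[%classic = J `|` I.
  have en : 0 <= eps *+ n by rewrite mulrn_wge0 // ltW.
  apply/seteqP; split => s; rewrite /J /I /= !in_itv /= c1 c2.
    move=> /andP[h1 h2]; have [h|h] := ltP s (al + eps *+ n); [left|right].
      by rewrite h1.
    exact: h2.
  move=> [/andP[h1 h2]|/andP[h1 h2]]; apply/andP; split=> //;
    last by apply: le_trans h1; rewrite lerDl.
  by apply: lt_le_trans h2 _; rewrite lerD2l mulrSr lerDl ltW.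
rewrite measureU // ge0_integral_setU //.
- rewrite muleDr //; first by apply: leeD => //; exact: piece.
  by apply: ge0_adde_def; rewrite inE integral_ge0 // => s _; rewrite lee_fin poisson_ge0.
- by apply/measurable_EFinP; apply: measurable_funTS; exact: measurable_poisson_fst.
- by move=> s _; rewrite lee_fin poisson_ge0.
- by apply/disj_setPS; rewrite JI0.
Qed.

(* The constant 10 is the loss in comparing [|s - z|] with [|c - z|] on intervals
   of length [eps] centered at [c]. *)
Lemma resolvent_Im_le_poisson :
  ((complex.Im (u y))%:E <= 10%:E * \int[mu]_s (poisson eps t s)%:E)%E.
Proof.
have [nu hnu] := roi_measure roi hu.
set P := (\int[mu]_s (poisson eps t s)%:E)%E.
have k0 : (0%R <= (10 / eps)%:E)%E by rewrite lee_fin divr_ge0 // ltW.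
(* Windows [[- N eps, N eps[] made of [N + N] cells; they exhaust the line, and continuity from
   below gives the bound for the whole of [nu]. *)
pose F (N : nat) : set (measurableTypeR R) :=
  `[- (eps *+ N), - (eps *+ N) + eps *+ (N + N)[%classic.
have mF N : measurable (F N) by exact: measurable_itv.
have FE N s : F N s <-> - (eps *+ N) <= s < eps *+ N.
  by rewrite /F /= in_itv /= mulrnDr addKr.
have FT : \bigcup_N F N = setT.
  apply/seteqP; split => // s _; exists (Num.trunc (`|s| / eps)).+1 => //.
  apply/FE; have := truncnS_gt (`|s| / eps); rewrite ltr_pdivrMr // mulr_natl.
  by rewrite ltr_norml => /andP[/ltW -> ->].
have ndF : nondecreasing_seq F.
  move=> m n mn; apply/subsetPset => s /FE /andP[h1 h2]; apply/FE.
  have : eps *+ m <= eps *+ n.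
    by rewrite -[leLHS]mulr_natl -[leRHS]mulr_natl ler_wpM2r ?ler_nat // ltW.
  by move=> h; apply/andP; split; lra.
have mUF : measurable (\bigcup_N F N) by exact: bigcupT_measurable.
have h := nondecreasing_cvg_mu (mu := nu) mF mUF ndF; rewrite FT in h.
have : (nu setT <= (10 / eps)%:E * P)%E.
  rewrite -(cvg_lim _ h) //; apply: lime_le; first by apply/cvg_ex; exists (nu setT).
  apply: nearW => N; apply: le_trans (pieces _ _ hnu) _.
  apply: lee_wpmul2l => //; apply: ge0_subset_integral => //.
  - by apply/measurable_EFinP; exact: measurable_poisson_fst.
  - by move=> s _; rewrite lee_fin poisson_ge0.
rewrite (scalar_measureE hu hnu measurableT) (roi_setT roi hu) resolvent_Im => le1.
rewrite EFinM (_ : (10%:E * P = eps%:E * ((10 / eps)%:E * P))%E).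
  by apply: lee_wpmul2l => //; rewrite lee_fin ltW.
by rewrite muleA -EFinM mulrCA divff ?mulr1 // gt_eqF.
Qed.

End Spectral.

(** * The Jacobi operator on a covering graph *)

Section JacobiOperator.
Variables (R : realType) (V D : finType) (G : graph V D) (B : V -> R) (A : D -> R).
Variables (VT DT : choiceType) (T : graph VT DT) (pv : VT -> V) (pd : DT -> D).
Hypothesis hcov : covering T G pv pd.
Local Open Scope classical_set_scope.
Local Open Scope complex_scope.

Let H := periodic_jacobi T pv pd B A.

Lemma lift_unique d d' : src T d = src T d' -> pd d = pd d' -> d = d'.
Proof.
move=> h1 h2; have [|d0 [_ hd0]] := cov_lift hcov (x := src T d) (e := pd d).
  exact: cov_src hcov d.
by rewrite -(hd0 d (conj erefl erefl)) -(hd0 d' (conj (esym h1) (esym h2))).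
Qed.

Lemma lift_exists x e : src G e = pv x -> exists d, src T d = x /\ pd d = e.
Proof. by move=> /(cov_lift hcov)[d [hd _]]; exists d. Qed.

(* The other end of the lift of [e] at [x], or [x] if there is none. *)
Definition nbr x e : VT :=
  if pselect (exists d, src T d = x /\ pd d = e) is left h
  then tgt T (projT1 (cid h)) else x.

Lemma nbrE d : nbr (src T d) (pd d) = tgt T d.
Proof.
rewrite /nbr; case: pselect => [h|[]]; last by exists d.
by have [h1 h2] := projT2 (cid h); congr tgt; exact: lift_unique.
Qed.

Lemma pv_tgt d : pv (tgt T d) = tgt G (pd d).
Proof. by rewrite /tgt -(cov_src hcov) (cov_rev hcov). Qed.

(** The covering map is a bijection from the darts at [x] to the darts at [pv x], so the sum runs
    over a fixed finite type. *)
Lemma periodic_jacobiE (u : VT -> R[i]) x : H u x = (B (pv x))%:C * u x +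
  \sum_(e | src G e == pv x) (A e)%:C * u (nbr x e).
Proof.
rewrite /H /periodic_jacobi; congr (_ + _).
rewrite (@bigfs _ _ _ _ (index_enum D) [pred e | src G e == pv x])
  ?index_enum_uniq //; last first.
  by move=> e _; rewrite mem_index_enum.
have -> : [set` [pred e | src G e == pv x]] = pd @` [set d | src T d = x].
  apply/seteqP; split => e /=; rewrite ?inE.
    by move=> /eqP/lift_exists[d [h1 h2]]; exists d.
  by move=> [d <- <-]; rewrite -(cov_src hcov) eqxx.
rewrite fsbig_image; last first.
  by move=> d d'; rewrite !inE /= => h h'; apply: lift_unique; rewrite h h'.
by apply: eq_fsbigr => d; rewrite inE /= => <-; rewrite nbrE.
Qed.

Lemma periodic_jacobi_linear (a : R[i]) u v :
  H (fun x => a * u x + v x) = fun x => a * H u x + H v x.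
Proof.
apply/funext => x; rewrite !periodic_jacobiE !mulrDr.
under eq_bigr do rewrite mulrDr.
rewrite big_split /= mulr_sumr; under eq_bigr do rewrite mulrCA.
by rewrite mulrCA; ring.
Qed.

Lemma l2_sum (I : Type) (r : seq I) (P : pred I) (u : I -> VT -> R[i]) :
  (forall i, P i -> l2 (u i)) -> l2 (fun x => \sum_(i <- r | P i) u i x).
Proof.
move=> h; elim: r => [|i r IH].
  rewrite (_ : (fun x => _) = fun=> 0); first exact: l2_0.
  by apply/funext => x; rewrite big_nil.
have -> : (fun x => \sum_(j <- i :: r | P j) u j x) =
    (fun x => (if P i then u i x else 0) + \sum_(j <- r | P j) u j x).
  by apply/funext => x; rewrite big_cons; case: ifP; rewrite ?add0r.
by apply: l2D => //; case: (boolP (P i)) => [/h //|_]; exact: l2_0.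
Qed.

(** For fixed [e] the hop is injective: the dart leading back is the unique lift of [drev G e] at
    the neighbour. Hence it cannot increase the norm. *)
Lemma l2_nbr e (u : VT -> R[i]) : l2 u ->
  l2 (fun x => if src G e == pv x then u (nbr x e) else 0).
Proof.
move=> hu; rewrite l2E; set Q := [set x | src G e = pv x].
have -> : (\esum_(x in [set: VT]) (sqn (if src G e == pv x then u (nbr x e) else 0))%:E)%E
    = (\esum_(x in Q) (sqn (u (nbr x e)))%:E)%E.
  rewrite [RHS]esum_mkcond; apply: eq_esum => x _.
  case: eqP => h; first by rewrite mem_set.
  by rewrite memNset // /sqn /= expr0n addr0.
have inj : set_inj Q (nbr ^~ e).
  move=> x x'; rewrite !inE /Q /= => /lift_exists[d [<- hd]] /lift_exists[d' [<- hd']].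
  rewrite -[in nbr (src T d) _]hd -[in nbr (src T d') _]hd' !nbrE => h.
  congr src; apply: (can_inj (drevK T)); apply: lift_unique => //.
  by rewrite !(cov_rev hcov) hd hd'.
rewrite -(esum_image Q (nbr ^~ e) (fun y => (sqn (u y))%:E)) //.
apply: le_lt_trans hu; rewrite esum_mkcond; apply: le_esum => x _.
by case: ifP => // _; rewrite lee_fin sqn_ge0.
Qed.

Lemma periodic_jacobi_l2 (u : VT -> R[i]) : l2 u -> l2 (H u).
Proof.
(* Sorting by the vertex or dart below makes each term a constant multiple of a truncated
   function. *)
move=> hu; rewrite (_ : H u = fun x => (\sum_v (B v)%:C * (if v == pv x then u x else 0)) +
    \sum_e (A e)%:C * (if src G e == pv x then u (nbr x e) else 0)).
  apply: l2D; apply: l2_sum => i _; apply: l2Z; last exact: l2_nbr.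
  rewrite l2E; apply: le_lt_trans hu; apply: le_esum => x _; rewrite lee_fin.
  by case: ifP => // _; rewrite {1}/sqn /= expr0n addr0 sqn_ge0.
apply/funext => x; rewrite periodic_jacobiE; congr (_ + _).
  rewrite (bigD1 (pv x)) //= eqxx big1 ?addr0 // => v /negPf ->.
  by rewrite mulr0.
by rewrite big_mkcond; apply: eq_bigr => e _; case: ifP; rewrite ?mulr0.
Qed.

End JacobiOperator.

(** * Reduced walks in a tree and paths to a root *)

Section ReducedWalks.
Variables (VT : Type) (DT : eqType) (T : graph VT DT).
Implicit Types (x y z : VT) (p q : seq DT) (d e : DT).

Let R d e := e != drev T d.

Lemma tgt_drev d : tgt T (drev T d) = src T d.
Proof. by rewrite /tgt drevK. Qed.

Lemma walk_cat x p y q z : walk T x p y -> walk T y q z -> walk T x (p ++ q) z.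
Proof.
by elim: p x => [|d p IH] x /=; [move=> <-|move=> [-> /IH h] /h].
Qed.

Lemma walk_rev x p y : walk T x p y -> walk T y (rev (map (drev T) p)) x.
Proof.
elim: p x => [|d p IH] x /=; first by move=> ->.
move=> [<- /IH h]; rewrite rev_cons -cats1; apply: walk_cat h _.
by rewrite /= tgt_drev.
Qed.

Lemma reducedP p : reduced T p <-> sorted R p.
Proof.
elim: p => [|d [|e p] IH] //=; split.
  by move=> [/eqP de /IH h]; apply/andP.
by move=> /andP[/eqP de h]; split=> //; apply/IH.
Qed.

Lemma sorted_revmap p : sorted R (rev (map (drev T) p)) = sorted R p.
Proof.
rewrite rev_sorted sorted_map; apply: eq_sorted => d e; rewrite /R /= drevK.
by rewrite eq_sym.
Qed.

Hypothesis hT : tree T.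

Lemma closed_reduced x p : walk T x p x -> reduced T p -> p = [::].
Proof. exact: hT.2. Qed.

(** If the first darts differ, the reverse of [p] followed by [q] is a nonempty reduced closed
    walk. *)
Lemma reduced_walk_unique x y p q : walk T x p y -> walk T x q y ->
  reduced T p -> reduced T q -> p = q.
Proof.
elim: p x q => [|d p IH] x q.
  by move=> /= <- wq _ /(closed_reduced wq) ->.
case: q => [|e q]; first by move=> + /= xy; rewrite xy => wp /(closed_reduced wp).
move=> wp wq rp rq; have [de|de] := eqVneq d e; last first.
  have w : walk T y (rev (map (drev T) (d :: p)) ++ e :: q) y.
    exact: walk_cat (walk_rev wp) wq.
  suff /(closed_reduced w) : reduced T (rev (map (drev T) (d :: p)) ++ e :: q).
    by move=> /(congr1 size); rewrite size_cat /= addnS.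
  move: rp rq => /reducedP rp /reducedP rq; apply/reducedP.
  have := sorted_revmap (d :: p); rewrite rp map_cons rev_cons => srt.
  rewrite /= in rq; rewrite cat_rcons; case: (rev _) srt => [|a s] /=.
    by move=> _; rewrite rq andbT /R drevK eq_sym.
  by rewrite rcons_path cat_path /= => /andP[-> ->]; rewrite rq /R drevK eq_sym de.
rewrite -de in wq rq *; congr cons.
move: wp wq => [_ wp] [_ wq]; apply: IH wp wq _ _.
  by move/reducedP: rp => /path_sorted/reducedP.
by move/reducedP: rq => /path_sorted/reducedP.
Qed.

Lemma reduced_walk_exists x y : exists p, walk T x p y /\ reduced T p.
Proof.
have [_ /(_ x y)[p]] := hT.1; elim: p x => [|d p IH] x /=.
  by move=> ->; exists [::].
move=> [<- /IH[q [wq rq]]]; case: q wq rq => [|e q] wq rq.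
  by exists [:: d].
have [ed|ed] := eqVneq e (drev T d); last first.
  by exists [:: d, e & q]; split=> //; split=> //; exact/eqP.
exists q; move: wq => [_]; rewrite ed tgt_drev => wq; split=> //.
by move/reducedP: rq => /path_sorted/reducedP.
Qed.

End ReducedWalks.

Section PathToRoot.
Variables (VT : Type) (DT : eqType) (T : graph VT DT) (root : VT).
Hypothesis hT : tree T.
Implicit Types (x y z : VT) (p q : seq DT) (d e : DT).

Definition path_to y : seq DT := projT1 (cid (reduced_walk_exists hT y root)).

Lemma path_to_walk y : walk T y (path_to y) root.
Proof. by case: (projT2 (cid (reduced_walk_exists hT y root))). Qed.

Lemma path_to_reduced y : reduced T (path_to y).
Proof. by case: (projT2 (cid (reduced_walk_exists hT y root))). Qed.

Lemma path_toE y p : walk T y p root -> reduced T p -> path_to y = p.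
Proof.
by move=> wp rp; apply: reduced_walk_unique (path_to_walk y) wp (path_to_reduced y) rp.
Qed.

Lemma path_to_inj x y : path_to x = path_to y -> x = y.
Proof.
move=> E; have := path_to_walk x; have := path_to_walk y; rewrite -E.
by case: (path_to x) => [|d p] /= => [-> ->|[-> _] [->]].
Qed.

Definition inward d := ohead (path_to (src T d)) == Some d.

Lemma path_to_inward d : inward d -> path_to (src T d) = d :: path_to (tgt T d).
Proof.
rewrite /inward; have := path_to_walk (src T d); have := path_to_reduced (src T d).
case: (path_to (src T d)) => // e p rp [_ wp] /eqP[E]; rewrite E in rp wp *.
congr cons; symmetry; apply: path_toE => //.
by move/reducedP: rp => /path_sorted/reducedP.
Qed.

Lemma path_to_outward d : ~~ inward d -> path_to (tgt T d) = drev T d :: path_to (src T d).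
Proof.
move=> hd; apply: path_toE; first by split=> //; rewrite tgt_drev; exact: path_to_walk.
move: hd; rewrite /inward; have := path_to_reduced (src T d).
case: (path_to _) => [|e p] //= rp hd; split=> //.
by rewrite drevK => E; rewrite E eqxx in hd.
Qed.

Lemma path_to_root : path_to root = [::].
Proof. exact: path_toE. Qed.

Lemma path_to_nil y : path_to y = [::] -> y = root.
Proof. by move=> h; have := path_to_walk y; rewrite h. Qed.

Lemma path_to_cons y d p : path_to y = d :: p ->
  [/\ src T d = y, inward d & path_to (tgt T d) = p].
Proof.
move=> h; have := path_to_walk y; rewrite h => -[sd _].
have id : inward d by rewrite /inward sd h.
by split=> //; have := path_to_inward id; rewrite sd h => -[].
Qed.

Lemma inward_drev d : ~~ inward d -> inward (drev T d).
Proof.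
move=> hd; rewrite /inward (_ : src T (drev T d) = tgt T d) // path_to_outward //.
Qed.

Lemma outward_drev d : inward d -> ~~ inward (drev T d).
Proof.
move=> hd; apply/negP => hd'; have := path_to_inward hd.
have := path_to_inward hd'; rewrite tgt_drev -/(tgt T d) => -> /(congr1 size) /=.
by move/eqP; rewrite -addn2 -[X in X == _]addn0 eqn_add2l.
Qed.

End PathToRoot.

(** * The finite system and the resolvent vector that it generates *)

Section SystemData.
Variables (R : realType) (V D : finType) (G : graph V D) (B : V -> R) (A : D -> R).

(* The unknown of index [inl d] is the m-function of the part of the tree beyond
   the dart [d]; that of index [inr v] is the diagonal Green function at [v]. *)
Definition jacobi_shift (i : D + V) : R :=
  match i with inl d => B (tgt G d) | inr v => B v end.

(** Eliminating the branch behind a dart [e] contributes the Schur complement [A_e^2 m_e] at its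
    source. Beyond [d], the branch behind [drev G d] is excluded, since it leads back. *)
Definition jacobi_weight (i j : D + V) : R :=
  match i, j with
  | inl d, inl e => if (src G e == tgt G d) && (e != drev G d) then A e ^+ 2 else 0
  | inr v, inl e => if src G e == v then A e ^+ 2 else 0
  | _, inr _ => 0
  end.

Lemma jacobi_weight_ge0 i j : 0 <= jacobi_weight i j.
Proof. by case: i j => [d|v] [e|w] //=; case: ifP => // _; exact: sqr_ge0. Qed.

End SystemData.

(** The list [l] may repeat entries, as the concatenations of cones are only compared by
    membership. *)
Lemma ler_sum_seq_sub (R : numDomainType) (X : eqType) (s l : seq X) (f : X -> R) :
  uniq s -> {subset s <= l} -> (forall x, 0 <= f x) ->
  \sum_(x <- s) f x <= \sum_(x <- l) f x.
Proof.
move=> us sl f0; elim: s l us sl => [|y s IH] l.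
  by rewrite big_nil => _ _; apply: sumr_ge0.
move=> /= /andP[ys us] sl; have yl : y \in l by apply: sl; exact: mem_head.
rewrite (perm_big _ (perm_to_rem yl)) !big_cons lerD2l; apply: IH => // x xs.
have : x \in y :: rem y l by rewrite -(perm_mem (perm_to_rem yl)) sl // inE xs orbT.
by rewrite inE => /predU1P[xy|//]; rewrite -xy xs in ys.
Qed.

Section ResolventVector.
Variables (R : realType) (V D : finType) (G : graph V D) (B : V -> R) (A : D -> R).
Hypothesis hArev : forall d : D, A (drev G d) = A d.
Variables (VT DT : choiceType) (T : graph VT DT) (pv : VT -> V) (pd : DT -> D).
Hypotheses (hT : tree T) (hcov : covering T G pv pd).
Local Open Scope classical_set_scope.
Local Open Scope complex_scope.
Variables (t eps : R) (m : D + V -> R[i]) (root : VT).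
Hypothesis eps0 : 0 < eps.
Hypothesis hm : herglotz (jacobi_shift G B) (jacobi_weight G A) (t +i* eps) m.

Let z := t +i* eps.
Let md d := m (inl d).
Let g := m (inr (pv root)).
Let pth := path_to root hT.

Let md_eq d : md d * (z - (B (tgt G d))%:C +
  \sum_(e | (src G e == tgt G d) && (e != drev G d)) (A e ^+ 2)%:C * md e) = -1.
Proof.
have [_ <-] := hm (inl d); congr (_ * (_ + _)).
rewrite big_sumType /= [X in _ + X]big1 ?addr0; last by move=> v _; rewrite mul0r.
by rewrite big_mkcond; apply: eq_bigr => e _; case: ifP => //; rewrite mul0r.
Qed.

Let g_eq : g * (z - (B (pv root))%:C +
  \sum_(e | src G e == pv root) (A e ^+ 2)%:C * md e) = -1.
Proof.
have [_ <-] := hm (inr (pv root)); congr (_ * (_ + _)).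
rewrite big_sumType /= [X in _ + X]big1 ?addr0; last by move=> v _; rewrite mul0r.
by rewrite big_mkcond; apply: eq_bigr => e _; case: ifP => //; rewrite mul0r.
Qed.

Let Im_md d : complex.Im (md d) = sqn (md d) * (eps +
  \sum_(e | (src G e == tgt G d) && (e != drev G d)) A e ^+ 2 * complex.Im (md e)).
Proof.
have := md_eq d; set w := (_ + _)%R => hw.
have -> : eps + \sum_(e | (src G e == tgt G d) && (e != drev G d))
    A e ^+ 2 * complex.Im (md e) = complex.Im w.
  rewrite /w !cImD cImN Im_sum /= subr0; congr (_ + _); apply: eq_bigr => e _.
  by rewrite cImM /= mul0r addr0.
case: (md d) w hw => a b [c e] [h1 h2]; rewrite /sqn /=.
apply/eqP; rewrite -subr_eq0.
have -> : b - (a ^+ 2 + b ^+ 2) * e = b * (1 + (a * c - b * e)) - a * (a * e + b * c).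
  by ring.
by rewrite h1 h2 oppr0 subrr !mulr0 subr0.
Qed.

(** Across a dart [d] pointing away from the root the resolvent is multiplied by [- A_d m_d]. The
    path runs towards the root, so each of its darts is reversed first. *)
Definition resolvent_vector (y : VT) : R[i] :=
  foldr (fun d c => - (A (pd d))%:C * m (inl (pd (drev T d))) * c) g (pth y).
Let u := resolvent_vector.

Let u_root : u root = g.
Proof. by rewrite /u /resolvent_vector /pth path_to_root. Qed.

Let u_outward d : ~~ inward root hT d ->
  u (tgt T d) = - (A (pd d))%:C * md (pd d) * u (src T d).
Proof.
move=> hd; rewrite /u /resolvent_vector /pth path_to_outward //=.
by rewrite drevK (cov_rev hcov) hArev.
Qed.

(** Off the root one dart leads to the parent and all others lead outward; inserting the ratios
    leaves the m-equation of the dart entering [y] from its parent. At the root it is the equation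
    of [g]. *)
Lemma resolvent_vector_eq y :
  periodic_jacobi T pv pd B A u y - z * u y = delta R root y.
Proof.
rewrite (periodic_jacobiE B A hcov).
have outE e d : src T d = y -> pd d = e -> ~~ inward root hT d ->
    (A e)%:C * u (nbr T pd y e) = - ((A e ^+ 2)%:C * md e) * u y.
  move=> <- <- hd; rewrite (nbrE hcov) // u_outward //.
  by rewrite expr2 rmorphM; ring.
have [[d0 [hd0 id0]]|nin] := pselect (exists d, src T d = y /\ inward root hT d).
  have yr : y != root.
    apply/eqP => yr; move: id0; rewrite /inward hd0 yr path_to_root.
    by [].
  set e0 := pd d0.
  have se0 : src G e0 = pv y by rewrite (cov_src hcov) hd0.
  rewrite (bigD1 e0) /=; last by rewrite se0.
  have -> : \sum_(e | (src G e == pv y) && (e != e0)) (A e)%:C * u (nbr T pd y e)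
      = \sum_(e | (src G e == tgt G (drev G e0)) && (e != drev G (drev G e0)))
          - ((A e ^+ 2)%:C * md e) * u y.
    rewrite drevK tgt_drev se0; apply: eq_bigr => e /andP[/eqP se ee0].
    have [d [hd pe]] := lift_exists hcov se.
    apply: (outE _ d) => //; apply/negP => id.
    move: id0 id ee0; rewrite /inward hd0 hd => /eqP -> /eqP[] d0d.
    by rewrite -pe -d0d eqxx.
  have hd0' : ~~ inward root hT (drev T d0) by exact: outward_drev.
  have hu : u y = - (A e0)%:C * md (drev G e0) * u (tgt T d0).
    by have := u_outward hd0'; rewrite tgt_drev hd0 (cov_rev hcov) hArev.
  have := md_eq (drev G e0); rewrite tgt_drev drevK se0.
  rewrite (_ : nbr T pd y e0 = tgt T d0); last by rewrite -hd0 (nbrE hcov).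
  rewrite -mulr_suml sumrN /delta (negPf yr) /=.
  set S := \sum_(e | _) _ => hS; move: hu; move: (u y) (u (tgt T d0)) => uy up ->.
  move: hS; move: (md _) => mm hS.
  transitivity ((A e0)%:C * up * (1 + mm * (z - (B (pv y))%:C + S))); first by ring.
  by rewrite hS subrr mulr0.
have yr : y = root.
  apply: (path_to_nil (hT := hT)); case E : (path_to root hT y) => [//|d p].
  by have [sd id _] := path_to_cons E; case: nin; exists d.
subst y; rewrite u_root /delta eqxx.
have -> : \sum_(e | src G e == pv root) (A e)%:C * u (nbr T pd root e)
    = \sum_(e | src G e == pv root) - ((A e ^+ 2)%:C * md e) * g.
  apply: eq_bigr => e /eqP/(lift_exists hcov)[d [hd pe]]; rewrite -u_root.
  by apply: (outE _ d) => //; apply/negP => id; apply: nin; exists d.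
rewrite -mulr_suml sumrN; move: g_eq; move: (\sum_(e | _) _) => S hS.
by rewrite -[RHS]opprK -hS; ring.
Qed.

(* The vertices at distance at most [n] from [y] whose path from [y] starts with
   the lift of [e]. *)
Fixpoint cone n y e : seq VT :=
  if n is n'.+1 then
    nbr T pd y e :: flatten [seq cone n' (nbr T pd y e) e'
      | e' <- enum D & (src G e' == tgt G e) && (e' != drev G e)]
  else [::].

(* The identity [Im m_d = |m_d|^2 (eps + sum A^2 Im m_e)] makes the sums over
   cones telescope. *)
Let cone_sum n d : ~~ inward root hT d ->
  eps * (\sum_(x <- cone n (src T d) (pd d)) sqn (u x)) <=
  A (pd d) ^+ 2 * complex.Im (md (pd d)) * sqn (u (src T d)).
Proof.
have Im0 e : 0 < complex.Im (md e) by case: (hm (inl e)).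
elim: n d => [|n IH] d hd.
  rewrite big_nil mulr0; apply: mulr_ge0; last exact: sqn_ge0.
  by apply: mulr_ge0; [exact: sqr_ge0 | exact/ltW/Im0].
rewrite /= big_cons big_flatten big_map big_filter (nbrE hcov) // big_enum_cond /=.
set w := tgt T d; set e := pd d.
rewrite mulrDr mulr_sumr.
have child e' : (src G e' == tgt G e) && (e' != drev G e) ->
    eps * (\sum_(x <- cone n w e') sqn (u x)) <=
    A e' ^+ 2 * complex.Im (md e') * sqn (u w).
  move=> /andP[/eqP se ee]; rewrite -(pv_tgt hcov) in se.
  have [d' [hd' pe]] := lift_exists hcov se; rewrite -/w in hd'.
  rewrite -hd' -pe; apply: IH; apply/negP => id'.
  have := path_to_inward id'; rewrite hd' (path_to_outward hd) => -[dd _].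
  by move: ee; rewrite -pe -dd (cov_rev hcov) eqxx.
apply: le_trans (lerD (lexx _) (ler_sum _ child)) _.
rewrite -mulr_suml -mulrDl (u_outward hd) !sqnM sqnN sqn_real -/e.
rewrite [complex.Im (md e)]Im_md le_eqVlt; apply/orP; left; apply/eqP.
by ring.
Qed.

(** The hypothesis says that the path from [x] to the root crosses [d] backwards. The induction
    removes the last dart of [s], the one next to [d], because [cone] unfolds from there. *)
Let cone_mem n d x s : ~~ inward root hT d ->
  pth x = s ++ drev T d :: pth (src T d) -> (size s < n)%N ->
  x \in cone n (src T d) (pd d).
Proof.
elim: n d s => [//|n IH] d s hd; case/lastP: s => [|s d'] E sn /=.
  have [_ _] := path_to_cons E; rewrite (nbrE hcov) // inE => E'.
  have [sx _ _] := path_to_cons E.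
  by rewrite -sx (_ : src T (drev T d) = tgt T d) // eqxx.
rewrite (nbrE hcov) // inE; apply/orP; right.
(* Every suffix of a path to the root is the path of a vertex on it. *)
have suffix s' x' q : pth x' = s' ++ q -> exists w, pth w = q.
  elim: s' x' => [|a s' IHs] x' /=; first by exists x'.
  by move=> h; have [_ _ h'] := path_to_cons h; exact: IHs h'.
rewrite cat_rcons in E; have [w1 E1] := suffix _ _ _ E.
have [_ id' E2] := path_to_cons E1.
have tw : tgt T d' = tgt T d.
  by apply: (path_to_inj (root := root) (hT := hT)); rewrite E2 path_to_outward.
have sw : src T (drev T d') = tgt T d by [].
apply/flatten_mapP; exists (pd (drev T d')).
  rewrite mem_filter mem_enum andbT (cov_src hcov) sw (pv_tgt hcov) eqxx /=.
  apply/negP => /eqP; rewrite -(cov_rev hcov) => h.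
  have dd : drev T d' = drev T d by apply: (lift_unique hcov).
  by have := outward_drev id'; rewrite dd inward_drev.
rewrite -sw; apply: (IH _ s); first exact: outward_drev.
  by rewrite drevK sw E /pth (path_to_outward hd).
by move: sn; rewrite size_rcons ltnS.
Qed.

(** Any finite set of vertices lies in a ball around the root, and [cone_sum] bounds the sums over
    balls by [C], whatever their radius. *)
Lemma resolvent_vector_l2 : l2 u.
Proof.
have Im0 e : 0 < complex.Im (md e) by case: (hm (inl e)).
pose ball n := root :: flatten [seq cone n root e | e <- enum D & src G e == pv root].
pose C := sqn g + \sum_(e | src G e == pv root) (A e ^+ 2 * complex.Im (md e) * sqn g) / eps.
have out d : src T d = root -> ~~ inward root hT d.
  by move=> sd; rewrite /inward sd path_to_root.
have ball_sum n : \sum_(x <- ball n) sqn (u x) <= C.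
  rewrite /ball big_cons big_flatten big_map big_filter big_enum_cond /= u_root lerD2l.
  apply: ler_sum => e /eqP/(lift_exists hcov)[d [sd <-]].
  by rewrite ler_pdivlMr // mulrC -[in cone _ _ _]sd -u_root -[in u root]sd cone_sum ?out.
have ball_mem n x : (size (pth x) <= n)%N -> x \in ball n.
  case/lastP E : (pth x) => [|s d]; first by rewrite (path_to_nil E) mem_head.
  rewrite size_rcons => sn; rewrite inE; apply/orP; right.
  have td : tgt T d = root.
    have : walk T x (pth x) root by exact: path_to_walk.
    rewrite E; clear; elim: s x => [|a s IH] x /=; first by case=> _.
    by case=> _; exact: IH.
  have sd : src T (drev T d) = root by [].
  apply/flatten_mapP; exists (pd (drev T d)).
    by rewrite mem_filter mem_enum andbT (cov_src hcov) sd eqxx.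
  rewrite -{1}sd; apply: (cone_mem (s := s)) => //; first exact: out.
  by rewrite drevK E sd /pth path_to_root cats1.
rewrite l2E; apply: (@le_lt_trans _ _ C%:E); last exact: ltry.
apply: ge_ereal_sup => _ [F [finF _] <-].
rewrite fsbig_finite // sumEFin lee_fin.
have := finmap.fset_uniq (fset_set F); move: (finmap.enum_fset (fset_set F)) => s us.
have := ball_sum (\max_(x <- s) size (pth x))%N; apply: le_trans.
apply: ler_sum_seq_sub => // [x xF|x]; last exact: sqn_ge0.
by apply: ball_mem; apply: leq_bigmax_seq.
Qed.

Lemma resolvent_vector_root : u root = m (inr (pv root)).
Proof. exact: u_root. Qed.

End ResolventVector.

(** * The exceptional set and the conclusion *)

Section ExceptionalSet.
Variables (R : realType) (V D : finType) (G : graph V D) (B : V -> R) (A : D -> R).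
Hypothesis hArev : forall d : D, A (drev G d) = A d.
Variables (VT DT : choiceType) (T : graph VT DT) (pv : VT -> V) (pd : DT -> D).
Hypotheses (hT : tree T) (hcov : covering T G pv pd).
Local Open Scope classical_set_scope.
Local Open Scope complex_scope.
Implicit Types (mu nu : {measure set (measurableTypeR R) -> \bar R}).

Let H : (VT -> R[i]) -> VT -> R[i] := periodic_jacobi T pv pd B A.
Variable E : set (measurableTypeR R) -> (VT -> R[i]) -> VT -> R[i].
Hypothesis hE : spectral_resolution H E.

Let Hl2 u : l2 u -> l2 (H u). Proof. exact: (periodic_jacobi_l2 B A hcov). Qed.
Let Hlin (a : R[i]) u v : l2 u -> l2 v ->
  H (fun x => a * u x + v x) = fun x => a * H u x + H v x.
Proof. by move=> _ _; exact: (periodic_jacobi_linear B A hcov). Qed.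

Let b := jacobi_shift G B.
Let a := jacobi_weight G A.

Let spectral_bounds x (t eps : R) m mu : 0 < eps -> herglotz b a (t +i* eps) m ->
  scalar_measure E (delta R x) mu ->
  (mu `](t - eps)%R, (t + eps)%R[%classic <=
     (eps * (2 * complex.Im (m (inr (pv x)))))%:E)%E /\
  ((complex.Im (m (inr (pv x))))%:E <= 10%:E * \int[mu]_s (poisson eps t s)%:E)%E.
Proof.
move=> e0 hm hmu; rewrite -(resolvent_vector_root A pv pd hT m x).
set u := resolvent_vector _ _ _ _ _ _.
have hu : l2 u := resolvent_vector_l2 hArev hT hcov x e0 hm.
have Hu y : H u y - (t +i* eps) * u y = delta R x y.
  exact: (resolvent_vector_eq hArev hT hcov x hm).
split.
- exact: (spectral_measure_itv_le Hl2 Hlin hE e0 hu Hu hmu).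
- exact: (resolvent_Im_le_poisson Hl2 Hlin hE e0 hu Hu hmu).
Qed.

(** [Z] is chosen before [x]: the system involves [x] only through the index [pv x], which takes
    finitely many values. *)
Lemma delta_spectral_measure_null : exists Z : seq R,
  forall x mu (N : set (measurableTypeR R)),
  scalar_measure E (delta R x) mu -> measurable N -> lebesgue_measure N = 0%E ->
  N `&` [set` Z] = set0 -> mu N = 0%E.
Proof.
have [Z hZ] := herglotz_unbounded_nbhs b a; exists Z => x mu N hmu mN N0 NZ.
pose i : D + V := inr (pv x).
have mu_fin : (mu setT < +oo)%E.
  by have [_] := hmu setT measurableT; rewrite ge0_fin_numE.
have bounded t : N t -> ~ herglotz_unbounded b a i t.
  move=> Nt /hZ[|d d0 hd].
    by apply/negP => tZ; have : (N `&` [set` Z]) t by []; rewrite NZ.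
  have ab : t - d / 2 < t + d / 2 by have : 0 < d / 2 by [rewrite divr_gt0]; lra.
  apply: (poisson_integral_blowup mu_fin ab) => s /andP[s1 s2] M.
  (* The 10 offsets the constant of [resolvent_Im_le_poisson]. *)
  have [|d' d'0 hd'] := hd s _ (10 * M).
    by rewrite ltr_norml; apply/andP; split; lra.
  exists d' => // eps eps_d; have /andP[e0 _] := eps_d.
  have [m [hm Mm]] := hd' eps eps_d.
  have [_ le_int] := spectral_bounds e0 hm hmu.
  rewrite -(@lee_pmul2l _ 10%:E) // -EFinM; apply: le_trans le_int.
  by rewrite lee_fin ltW.
apply: null_set_bounded_density => // t /bounded /existsNP[M] /existsNP[d].
(* Below [d] every solution has imaginary part at most [M]; the 2 is the constant of
   [spectral_measure_itv_le]. *)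
move=> /not_implyP[d0 hd]; exists (2 * M), d; split=> // eps eps_d.
have /andP[e0 _] := eps_d.
have [m hm] := herglotz_exists b (@jacobi_weight_ge0 _ _ _ G A) t e0.
have [le_mu _] := spectral_bounds e0 hm hmu.
apply: le_trans le_mu _; rewrite lee_fin !ler_pM2l // leNgt; apply/negP => Mm.
by apply: hd; exists eps; split=> //; exists m.
Qed.

End ExceptionalSet.

Lemma measure_seq_null (R : realType) (mu : {measure set (measurableTypeR R) -> \bar R})
    (Z : seq R) :
  (forall x, mu [set x]%classic = 0%E) -> mu [set` Z]%classic = 0%E.
Proof.
move=> h; elim: Z => [|x Z IH]; first by rewrite set_nil measure0.
have mx : measurable ([set x]%classic : set (measurableTypeR R)).
  exact: measurable_set1.
have mZ : measurable ([set` Z]%classic : set (measurableTypeR R)).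
  exact: countable_measurable (finite_set_countable (finite_seq Z)).
have -> : [set` x :: Z]%classic = ([set x] `|` [set` Z])%classic.
  by apply/seteqP; split=> y /=; rewrite inE => /predU1P.
apply/eqP; rewrite eq_le measure_ge0 andbT.
apply: le_trans (measureU2 mu mx mZ) _.
by rewrite [X in (X + _ <= _)%E]h [X in (_ + X <= _)%E]IH adde0.
Qed.

Theorem theorem6p7 (R : realType) (V D : finType) (G : graph V D)
    (hconn : connected_graph G)
    (hend : forall v : V, exists d : D, src G d = v)
    (hleaf : forall v : V, deg G v <> 1%N)
    (B : V -> R) (A : D -> R)
    (hApos : forall d : D, 0 < A d)
    (hArev : forall d : D, A (drev G d) = A d)
    (VT DT : choiceType) (T : graph VT DT) (pv : VT -> V) (pd : DT -> D)
    (hT : universal_cover T G pv pd) :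
  no_singular_continuous_spectrum (periodic_jacobi T pv pd B A).
Proof.
move=> u mu nu hu [E [hE hmu]] [ac [pp [_ [[N [mN N0 nuN]] nu1] _ mu_sum]]] S mS.
case: hT => tree_T hcov.
have [Z hZ] := delta_spectral_measure_null hArev tree_T hcov hE.
have nuZ : nu [set` Z]%classic = 0%E by exact: measure_seq_null.
have mZ : measurable ([set` Z]%classic : set (measurableTypeR R)).
  exact: countable_measurable (finite_set_countable (finite_seq Z)).
pose N' := (N `\` [set` Z])%classic.
have mN' : measurable N' by exact: measurableD.
have leb_N' : lebesgue_measure N' = 0%E.
  apply/eqP; rewrite eq_le measure_ge0 andbT -[leRHS]N0.
  by apply: le_measure; rewrite ?inE //; exact: subDsetl.
have E_delta x : E N' (delta R x) = fun=> 0.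
  have [la hla] := roi_measure hE.1 (l2_delta R x).
  apply: nrm2_eq0; first exact: (proj_l2 (roi_proj hE.1 mN') (l2_delta R x)).
  have := scalar_measureE hE (l2_delta R x) hla mN'.
  rewrite (hZ x la N') //; first by move=> [].
  by rewrite /N' setDE -setIA setICl setI0.
(* Each value of [E N' u] is its product with some [delta]; by symmetry the projection moves onto
   [delta], where it vanishes. *)
have E_u : E N' u = fun=> 0.
  apply/funext => x; rewrite -dot_delta.
  rewrite -(proj_sym (roi_proj hE.1 mN') (l2_delta R x) hu) E_delta.
  exact: dot0l.
have muN' : mu N' = 0%E.
  rewrite (scalar_measureE hE hu hmu mN') E_u /nrm2 esum1 // => x _.
  by rewrite /sqn /= expr0n addr0.
have nuN' : nu N' = 0%E.
  apply/eqP; rewrite eq_le measure_ge0 andbT -[leRHS]muN' mu_sum //.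
  by rewrite addeAC leeDr // adde_ge0.
(* All three pieces are [nu]-null: [N'] because [nu <= mu], [Z] because [nu] has no atoms, and the
   complement of [N] because [nu] is carried by [N]. *)
have SN : (S `<=` N' `|` ([set` Z] `|` ~` N))%classic.
  move=> t _; have [tN|tN] := pselect (N t); last by right; right.
  by have [tZ|tZ] := pselect ([set` Z]%classic t); [right; left|left].
have mCN : measurable (~` N)%classic by exact: measurableC.
have mZN : measurable ([set` Z] `|` ~` N)%classic by exact: measurableU.
apply/eqP; rewrite eq_le measure_ge0 andbT.
apply: le_trans (le_measure nu _ _ SN) _; rewrite ?inE //; first exact: measurableU.
apply: le_trans (measureU2 nu mN' mZN) _; rewrite [X in (X + _ <= _)%E]nuN' add0e.
apply: le_trans (measureU2 nu mZ mCN) _.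
by rewrite [X in (X + _ <= _)%E]nuZ [X in (_ + X <= _)%E]nuN adde0.
Qed.
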